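(* Let $k\in\mathbb R$ and consider the boundary equation \[ (2i\,\mathsf I+k\mathsf T)\psi=\mathsf Bg \qquad(\ast) \] for $g\in L^2(\partial\mathbb D)$ and unknown $\psi\in L^2(\partial\mathbb D)$. (i) If $|k|<1$, then for every $g\in L^2(\partial\mathbb D)$ equation $(\ast)$ has a unique solution $\psi\in L^2(\partial\mathbb D)$, given by \[ \psi=y+i\mathsf Hy,\qquad y=\frac1{2i}\sum_{n=0}^\infty(-k\mathsf M_s\mathsf H)^n\,\Pi_+g . \] (ii) If $|k|=1$, then there exists $g\in L^2(\partial\mathbb D)$ for which $(\ast)$ has no solution $\psi\in L^2(\partial\mathbb D)$. (iii) If $|k|>1$, then the operator $\mathsf I+k\mathsf C$ on $L^2_+$ is surjective but not injective. Consequently, for every $g\in L^2(\partial\mathbb D)$ equation $(\ast)$ has a solution $\psi\in L^2(\partial\mathbb D)$, and solutions are not unique. The solutions of $(\ast)$ are of the form $\psi=y+i\mathsf Hy$ with $y\in L^2_+$, and the orthogonality condition $\langle y,1\rangle=0$ selects the solution with \[ y=-\frac1{2i}\sum_{n=0}^\infty\frac1{k^{n+1}}(\mathsf H\mathsf M_s)^{n+1}\,\Pi_+g ; \] this selection defines a bounded linear operator $g\mapsto\tilde g=(\mathsf I-\mathsf R)\psi$ on $L^2(\partial\mathbb D)$.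
   Context: Operators on $L^2=L^2(\partial\mathbb D)$, $\partial\mathbb D\cong\mathbb R/2\pi\mathbb Z$, with $\langle f,g\rangle=\frac1{2\pi}\int_{-\pi}^{\pi}f\bar g\,d\theta$: $\mathsf M_s$ is multiplication by $\mathsf s(\theta)=\operatorname{sgn}(\cos\theta)$; $\mathsf Rf(\theta)=f(\pi-\theta)$; $\Pi_+=\frac12(\mathsf I+\mathsf R)$; $L^2_+=\{f\in L^2:\mathsf Rf=f\}$; $\mathsf P^+f=\sum_{n\ge0}\hat f(n)e^{in\theta}$ and $\mathsf P^-=\mathsf I-\mathsf P^+$; $\mathsf B=\mathsf P^++\mathsf R\mathsf P^-$; $\mathsf T=\mathsf B\mathsf M_s(\mathsf I-\mathsf R)$; $\mathsf H$ is the Hilbert transform, $\mathsf He^{in\theta}=-i\,\operatorname{sgn}(n)e^{in\theta}$ with $\operatorname{sgn}0=0$; $\mathsf C=\mathsf M_s\mathsf H|_{L^2_+}$, which maps $L^2_+$ into itself. *)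

(* Defs.v *)
From HB Require Import structures.
From mathcomp Require Import all_boot all_order all_algebra.
From mathcomp Require Import all_classical all_reals all_analysis.
From mathcomp Require Export complex.

Set Implicit Arguments.
Unset Strict Implicit.
Unset Printing Implicit Defensive.
Import Order.TTheory GRing.Theory Num.Theory.
Import numFieldNormedType.Exports.

Local Open Scope classical_set_scope.
Local Open Scope ring_scope.
Local Open Scope complex_scope.

(* A function on the circle R/2piZ is represented by a 2pi-periodic function
   of the angle (periodicity is part of [L2] below).  The values are given the
   type R[i]^o so that functions form a left module over R[i]. *)
Definition circfun (R : realType) : Type := R -> (R[i])^o.

Section Circle.
Context {R : realType}.
Implicit Types (f g h psi y : circfun R) (k : R).

Definition arc : set (measurableTypeR R) := [set` `[- pi, pi]].

Lemma measurable_arc : measurable arc.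
Proof. exact: measurable_itv. Qed.

Lemma inv2pi_ge0 : 0 <= (2 * pi)^-1 :> R.
Proof. by rewrite invr_ge0 mulr_ge0 // pi_ge0. Qed.

(* d theta / 2pi on [-pi, pi] *)
Definition circle_measure : {measure set (measurableTypeR R) -> \bar R} :=
  mscale (NngNum inv2pi_ge0) (mrestr lebesgue_measure measurable_arc).

Definition L2norm f : \bar R :=
  Lnorm circle_measure 2%:E (fun t => (Normc.normc (f t))%:E).

Definition L2 f : Prop :=
  [/\ forall t, f (t + 2 * pi) = f t,
      measurable_fun [set: measurableTypeR R] (fun t => complex.Re (f t)),
      measurable_fun [set: measurableTypeR R] (fun t => complex.Im (f t)) &
      (L2norm f < +oo)%E].

(* equality in L^2 is equality almost everywhere *)
Definition ae_equal f g : Prop := f = g %[ae circle_measure].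

Definition L2cvg (u : nat -> circfun R) h : Prop :=
  L2norm (u n - h) @[n --> \oo] --> 0%E.

(* the L^2 limit, chosen among its a.e.-equal versions (0 if there is none) *)
Definition L2lim (u : nat -> circfun R) : circfun R :=
  xget 0 [set h | L2 h /\ L2cvg u h].

Definition inner f g : R[i] :=
  (\int[circle_measure]_t complex.Re (f t * (g t)^*%C)) +i*
  (\int[circle_measure]_t complex.Im (f t * (g t)^*%C)).

(* e^{i n theta} *)
Definition expi (n : int) : circfun R :=
  fun t => cos (n%:~R * t) +i* sin (n%:~R * t).

Definition fourier f (n : int) : R[i] := inner f (expi n).

(* \sum_n c n * fourier f n * e^{i n theta} in L^2, over symmetric partial sums
   |n| <= N: the operator mapping e^{i n theta} to c n * e^{i n theta} *)
Definition multiplier (c : int -> R[i]) f : circfun R :=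
  L2lim (fun N => \sum_(m < N.*2.+1)
    (c (m%:Z - N%:Z) * fourier f (m%:Z - N%:Z)) *: expi (m%:Z - N%:Z)).

Definition opM f : circfun R := fun t => (Num.sg (cos t))%:C * f t.

Definition opR f : circfun R := fun t => f (pi - t).

Definition opPi f : circfun R := 2^-1 *: (f + opR f).

Definition L2plus f : Prop := L2 f /\ ae_equal (opR f) f.

Definition opPplus f : circfun R :=
  multiplier (fun n => if 0 <= n then 1 else 0) f.

Definition opPminus f : circfun R := f - opPplus f.

Definition opB f : circfun R := opPplus f + opR (opPminus f).

Definition opT f : circfun R := opB (opM (f - opR f)).

Definition opH f : circfun R := multiplier (fun n => - 'i%C * (sgz n)%:~R) f.

Definition opC f : circfun R := opM (opH f).

Definition boundary_eq k g psi : Prop :=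
  ae_equal ((2 * 'i%C) *: psi + k%:C *: opT psi) (opB g).

(* Linearity and the bound make [G] descend to a.e. classes. *)
Definition bounded_linear_L2 (G : circfun R -> circfun R) : Prop :=
  [/\ forall f, L2 f -> L2 (G f),
      forall (a : R[i]) f g, L2 f -> L2 g ->
        ae_equal (G (a *: f + g)) (a *: G f + G g) &
      exists M : R, forall f, L2 f -> (L2norm (G f) <= M%:E * L2norm f)%E].

End Circle.

(* Main.v *)
Require Import Defs.
From mathcomp Require Import all_boot all_order all_algebra.
From mathcomp Require Import all_classical all_reals all_analysis.
From mathcomp Require Import measurable_realfun zify ring lra.
Import Order.TTheory GRing.Theory Num.Theory.
Import numFieldNormedType.Exports.
Local Open Scope classical_set_scope.
Local Open Scope ring_scope.
Local Open Scope complex_scope.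
Set Implicit Arguments.
Unset Strict Implicit.
Unset Printing Implicit Defensive.

(** Write P for the projection opPi = (I + R)/2 onto L^2_+, M for opM, H for
    opH, B for opB and C = MH.  The Fourier coefficients of B f are those of
    P f multiplied by 1 + sgn n, and so are those of (I + iH) P f: hence
    B = (I + iH) P (fourier_opB, fourier_cauchy).  Every term of the boundary
    equation other than 2i psi lies in the range of B, so psi has no negative
    frequencies, which forces psi = y + iHy with y = P psi (boundary_form).
    As R anticommutes with H, (I - R) psi = 2i Hy, and the equation becomes
    (I + kC) y = P g / 2i on L^2_+ (boundary_IkC).

    Three facts govern C.  M is an isometric involution; H^2 = -I off the
    constants; and M y has mean zero for y in L^2_+, because R anticommutes
    with M.  Hence C is a contraction, HM is an isometry of L^2_+ into the
    functions of mean zero, and C(HM) = -I on L^2_+ (MHHM).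

    - If |k| < 1, the Neumann series of -kC inverts I + kC (neumann,
      subcritical_solution, subcritical_unique).
    - If |k| > 1, let s be the sum of the Neumann series of HM/k started at
      HM h/k.  It satisfies ks = HM(h + s), so kC s = - (h + s) and y = -s solves
      (I + kC) y = h (supercritical_solution).  It has mean zero, and it is the
      only such solution, since C preserves norms of functions of mean zero
      (supercritical_kernel).  For h = 1 it gives a second preimage of 1, next
      to 1 itself: the kernel of I + kC is not zero (IkC_kernel).
    - If |k| = 1, the vectors e_n = (HM)^n 1 are orthonormal (inner_chain), and
      the adjoint of C maps e_n to - e_(n+1).  Let h be the sum of the
      k^n/(n+1) e_n.  If (I + kC) y = P h, the numbers r_n = <y, e_n> satisfy
      r_n - k r_(n+1) = k^n/(n+1); multiplied by k^n and summed, this bounds the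
      partial sums of the harmonic series by 2 ||y||, which is absurd
      (resonance_unsolvable).

    Computing with coefficients rests on two theorems of analysis.  Completeness
    of L^2 (L2_complete) makes the partial sums defining a multiplier converge
    (multiplierP).  Completeness of the exponentials (fourier_inj) lets
    equalities almost everywhere be checked on coefficients: a function
    orthogonal to all exponentials is orthogonal to the trigonometric
    polynomials (1 - x^n)^(2^n), x a raised cosine, which converge boundedly to
    the indicator of an arc; its integrals over arcs vanish, and it is zero by
    Lebesgue differentiation. *)

(* Simplification would unfold the measure into its construction. *)
Arguments circle_measure : simpl never.

(** * Square-integrable functions on the circle *)

Section L2Space.
Context {R : realType}.
Implicit Types (f g h : circfun R) (a : R[i]).
Local Notation mu := (@circle_measure R).
Local Notation T := (measurableTypeR R).

Lemma circle_measureE (A : set T) :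
  mu A = ((2 * pi)^-1%:E * lebesgue_measure (A `&` Defs.arc))%E.
Proof. by []. Qed.

Lemma circle_measureT : mu setT = 1%E.
Proof.
rewrite circle_measureE setTI lebesgue_measure_itv /= lte_fin.
have p0 : (0 : R) < pi := pi_gt0 R.
rewrite ifT; last by lra.
rewrite -EFinD -EFinM; congr EFin.
by rewrite opprK -mulr2n -(mulr_natl pi 2) mulVf// mulf_neq0 ?pnatr_eq0// lt0r_neq0.
Qed.

Definition absq (z : R[i]) : R := complex.Re z ^+ 2 + complex.Im z ^+ 2.

Lemma absq_ge0 z : 0 <= absq z.
Proof. by rewrite addr_ge0 ?sqr_ge0. Qed.

Lemma normc_sqrt (z : R[i]) : Normc.normc z = Num.sqrt (absq z).
Proof. by case: z. Qed.

Lemma absq_mulJ (z : R[i]) : (absq z)%:C = z * z^*%C.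
Proof. by case: z => x y; simpc; congr Complex; rewrite /absq /=; ring. Qed.

Lemma L2normE f :
  L2norm f = ((\int[mu]_t (absq (f t))%:E) `^ 2^-1)%E.
Proof.
rewrite /L2norm unlock; congr (poweR _ _); apply: eq_integral => t _.
rewrite normc_sqrt /= ger0_norm ?sqrtr_ge0//; congr EFin.
by rewrite powR_mulrn ?sqrtr_ge0// sqr_sqrtr ?absq_ge0.
Qed.

Definition mfunC f : Prop :=
  measurable_fun [set: T] (fun t => complex.Re (f t)) /\
  measurable_fun [set: T] (fun t => complex.Im (f t)).

Lemma measurable_absq f : mfunC f -> measurable_fun [set: T] (fun t => absq (f t)).
Proof.
by move=> [mr mi]; apply: measurable_funD; apply: measurable_funX.
Qed.

Lemma L2P f : L2 f <-> [/\ (forall t, f (t + 2 * pi) = f t), mfunC f &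
   mu.-integrable setT (fun t => (absq (f t))%:E)].
Proof.
rewrite /L2 L2normE.
have e0 : (0 <= \int[mu]_t (absq (f t))%:E)%E.
  by apply: integral_ge0 => t _; rewrite lee_fin absq_ge0.
split=> [[pf mr mi fin]|[pf [mr mi] fin]]; split => //.
  have mf : mfunC f by [].
  apply/integrableP; split.
    by apply/measurable_EFinP; exact: measurable_absq.
  under eq_integral do rewrite gee0_abs ?lee_fin ?absq_ge0//.
  move: fin e0; case: (integral _ _ _) => //= [r _ _|]; first exact: ltry.
  by rewrite invr_eq0 pnatr_eq0.
move/integrableP: fin => [_].
under eq_integral do rewrite gee0_abs ?lee_fin ?absq_ge0//.
by move: e0; case: (integral _ _ _) => [r||] //= _ _; exact: ltry.
Qed.

Lemma L2_mfunC f : L2 f -> mfunC f.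
Proof. by move/L2P => []. Qed.

Lemma L2_period f : L2 f -> forall t, f (t + 2 * pi) = f t.
Proof. by move/L2P => []. Qed.

Lemma L2_integrable f : L2 f -> mu.-integrable setT (fun t => (absq (f t))%:E).
Proof. by move/L2P => []. Qed.

Notation rint F := (mu.-integrable setT (EFin \o (F : T -> R))).

Lemma rint_cst (c : R) : rint (fun=> c).
Proof.
apply/integrableP; split; first by apply/measurable_EFinP; exact: measurable_cst.
rewrite (_ : (fun x => _) = cst (`|c|%:E)); last by apply/funext.
by rewrite integral_cst// circle_measureT mule1 ltry.
Qed.

Lemma rintD (F G : T -> R) : rint F -> rint G -> rint (fun t => F t + G t).
Proof. exact: integrableD. Qed.

Lemma rintZ (c : R) (F : T -> R) : rint F -> rint (fun t => c * F t).
Proof. exact: integrableZl. Qed.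

Lemma rint_le (F G : T -> R) : measurable_fun setT F ->
  rint G -> (forall t, `|F t| <= G t) -> rint F.
Proof.
move=> mF iG FG; apply: le_integrable iG => //; first exact/measurable_EFinP.
move=> t _ /=; rewrite lee_fin (le_trans (FG t))//.
exact: ler_norm.
Qed.

Lemma L2_dominated f (G : T -> R) :
  (forall t, f (t + 2 * pi) = f t) -> mfunC f ->
  rint G -> (forall t, absq (f t) <= G t) -> L2 f.
Proof.
move=> pf mf iG fG; apply/L2P; split => //.
apply: (rint_le _ iG); first exact: measurable_absq.
by move=> t; rewrite ger0_norm ?absq_ge0.
Qed.

Lemma mfunCD f g : mfunC f -> mfunC g -> mfunC (f + g).
Proof.
move=> [fr fi] [gr gi]; split.
  rewrite (_ : (fun t => _) = (fun t => complex.Re (f t)) \+ (fun t => complex.Re (g t))).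
    exact: measurable_funD.
  by apply/funext => t /=; rewrite /GRing.add /=; case: (f t) (g t) => a b [].
rewrite (_ : (fun t => _) = (fun t => complex.Im (f t)) \+ (fun t => complex.Im (g t))).
  exact: measurable_funD.
by apply/funext => t /=; rewrite /GRing.add /=; case: (f t) (g t) => a b [].
Qed.

Lemma cReM (z w : R[i]) : complex.Re (z * w) =
  complex.Re z * complex.Re w - complex.Im z * complex.Im w.
Proof. by case: z w => a b []. Qed.
Lemma cImM (z w : R[i]) : complex.Im (z * w) =
  complex.Re z * complex.Im w + complex.Im z * complex.Re w.
Proof. by case: z w => a b []. Qed.

Lemma mfunCM f g : mfunC f -> mfunC g -> mfunC (fun t => f t * g t).
Proof.
move=> [fr fi] [gr gi]; split.
  under eq_fun do rewrite cReM.
  by apply: measurable_funB; apply: measurable_funM.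
under eq_fun do rewrite cImM.
by apply: measurable_funD; apply: measurable_funM.
Qed.

Lemma mfunC_cst a : mfunC (fun=> a).
Proof. by split; exact: measurable_cst. Qed.

Lemma mfunCZ a f : mfunC f -> mfunC (a *: f).
Proof. by move=> mf; apply: (mfunCM (mfunC_cst a) mf). Qed.

Lemma mfunCJ f : mfunC f -> mfunC (fun t => (f t)^*%C).
Proof.
move=> [fr fi]; split.
  rewrite (_ : (fun t => _) = (fun t => complex.Re (f t)))//.
  by apply/funext => t; case: (f t).
rewrite (_ : (fun t => _) = \- (fun t => complex.Im (f t))).
  exact: measurable_funN.
by apply/funext => t /=; case: (f t).
Qed.

Lemma cReD (z w : R[i]) : complex.Re (z + w) = complex.Re z + complex.Re w.
Proof. by case: z w => a b []. Qed.
Lemma cImD (z w : R[i]) : complex.Im (z + w) = complex.Im z + complex.Im w.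
Proof. by case: z w => a b []. Qed.

Lemma absqD z w : absq (z + w) <= 2 * absq z + 2 * absq w.
Proof.
case: z w => a b [c d]; rewrite /absq /=.
have := sqr_ge0 (a - c); have := sqr_ge0 (b - d); nra.
Qed.

Lemma absqM z w : absq (z * w) = absq z * absq w.
Proof. by case: z w => a b [c d]; rewrite /absq /=; ring. Qed.

Lemma L2D f g : L2 f -> L2 g -> L2 (f + g).
Proof.
move=> /L2P[pf mf intf] /L2P[pg mg intg].
apply: (@L2_dominated _ (fun t => 2 * absq (f t) + 2 * absq (g t))).
- by move=> t; rewrite /GRing.add /= pf pg.
- exact: mfunCD.
- by apply: rintD; apply: rintZ.
- by move=> t; exact: absqD.
Qed.

Lemma L2Z a f : L2 f -> L2 (a *: f).
Proof.
move=> /L2P[pf mf intf].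
apply: (@L2_dominated _ (fun t => absq a * absq (f t))).
- by move=> t; rewrite /GRing.scale /= pf.
- exact: mfunCZ.
- exact: rintZ.
- by move=> t; rewrite absqM.
Qed.

Lemma L2N f : L2 f -> L2 (- f).
Proof. by rewrite -scaleN1r; exact: L2Z. Qed.

Lemma L2B f g : L2 f -> L2 g -> L2 (f - g).
Proof. by move=> hf hg; apply: L2D => //; exact: L2N. Qed.

Lemma L2_bounded f (M : R) :
  (forall t, f (t + 2 * pi) = f t) -> mfunC f ->
  (forall t, absq (f t) <= M) -> L2 f.
Proof.
by move=> pf mf fM; apply: (L2_dominated pf mf (rint_cst M)) => t.
Qed.

Lemma L20 : L2 (0 : circfun R).
Proof.
apply: (@L2_bounded (fun=> 0) 0) => //.
by move=> t; rewrite /absq /= expr0n addr0.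
Qed.

Lemma L2_sum (I : Type) (r : seq I) (F : I -> circfun R) :
  (forall i, L2 (F i)) -> L2 (\sum_(i <- r) F i).
Proof. by move=> h; elim/big_ind: _ => //; [exact: L20|exact: L2D]. Qed.

End L2Space.
#[export] Hint Resolve L2D L2Z L2N L2B L20 : core.

(** * The inner product and the norm *)

Section Inner.
Context {R : realType}.
Implicit Types (f g h : circfun R) (a : R[i]).
Local Notation mu := (@circle_measure R).
Local Notation T := (measurableTypeR R).
Notation rint F := (mu.-integrable setT (EFin \o (F : T -> R))).

(** Re and Im of f times conj g are at most |f|^2 + |g|^2 in absolute value. *)
Lemma rint_inner f g : L2 f -> L2 g ->
  rint (fun t => complex.Re (f t * (g t)^*%C)) /\
  rint (fun t => complex.Im (f t * (g t)^*%C)).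
Proof.
move=> hf hg; have [mr mi] := mfunCM (L2_mfunC hf) (mfunCJ (L2_mfunC hg)).
have hb : rint (fun t => absq (f t) + absq (g t)).
  by apply: rintD; exact: L2_integrable.
split; apply: (rint_le _ hb) => // t;
  case: (f t) (g t) => a b [c d]; rewrite /absq /= ler_norml; apply/andP; split.
- have := sqr_ge0 (a + c); have := sqr_ge0 (b + d); nra.
- have := sqr_ge0 (a - c); have := sqr_ge0 (b - d); nra.
- have := sqr_ge0 (a - d); have := sqr_ge0 (b + c); nra.
- have := sqr_ge0 (a + d); have := sqr_ge0 (b - c); nra.
Qed.

Lemma innerDl f g h : L2 f -> L2 g -> L2 h ->
  inner (f + g) h = inner f h + inner g h.
Proof.
move=> hf hg hh; have [fr fi] := rint_inner hf hh; have [gr gi] := rint_inner hg hh.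
rewrite /inner; simpc; congr Complex.
  rewrite -RintegralD//; apply: eq_Rintegral => t _.
  by rewrite -cReD -mulrDl.
rewrite -RintegralD//; apply: eq_Rintegral => t _.
by rewrite -cImD -mulrDl.
Qed.

Lemma innerZl a f g : L2 f -> L2 g -> inner (a *: f) g = a * inner f g.
Proof.
move=> hf hg; have [fr fi] := rint_inner hf hg.
case: a => a b; rewrite /inner; simpc; congr Complex.
  rewrite -RintegralZl// -RintegralZl// -RintegralB//; [|exact: rintZ..].
  by apply: eq_Rintegral => t _; rewrite -[in LHS]mulrA cReM.
rewrite -RintegralZl// -RintegralZl// -RintegralD//; [|exact: rintZ..].
by apply: eq_Rintegral => t _; rewrite -[in LHS]mulrA cImM.
Qed.

Lemma innerC f g : L2 f -> L2 g -> inner g f = (inner f g)^*%C.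
Proof.
move=> hf hg; have [fr fi] := rint_inner hf hg.
rewrite /inner /=; congr Complex.
  apply: eq_Rintegral => t _.
  by case: (f t) (g t) => a b [c d] /=; ring.
rewrite -mulN1r -RintegralZl//; apply: eq_Rintegral => t _.
by case: (f t) (g t) => x b [c d] /=; ring.
Qed.

Lemma innerDr f g h : L2 f -> L2 g -> L2 h ->
  inner f (g + h) = inner f g + inner f h.
Proof.
move=> hf hg hh; rewrite (innerC (L2D hg hh) hf) innerDl//.
by rewrite (innerC hg hf) (innerC hh hf) rmorphD.
Qed.

Lemma innerZr a f g : L2 f -> L2 g -> inner f (a *: g) = a^*%C * inner f g.
Proof.
move=> hf hg; rewrite (innerC (L2Z a hg) hf) innerZl//.
by rewrite (innerC hg hf) rmorphM.
Qed.

Lemma innerNl f g : L2 f -> L2 g -> inner (- f) g = - inner f g.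
Proof. by move=> hf hg; rewrite -scaleN1r innerZl// mulN1r. Qed.

Lemma innerBl f g h : L2 f -> L2 g -> L2 h ->
  inner (f - g) h = inner f h - inner g h.
Proof. by move=> hf hg hh; rewrite innerDl ?innerNl//; exact: L2N. Qed.

Lemma innerNr f g : L2 f -> L2 g -> inner f (- g) = - inner f g.
Proof. by move=> hf hg; rewrite -scaleN1r innerZr// rmorphN1 mulN1r. Qed.

Lemma inner0l g : L2 g -> inner 0 g = 0.
Proof. by move=> hg; rewrite -(scale0r 0) innerZl ?mul0r//; exact: L20. Qed.

Lemma inner_suml (I : Type) (r : seq I) (F : I -> circfun R) g :
  L2 g -> (forall i, L2 (F i)) ->
  inner (\sum_(i <- r) F i) g = \sum_(i <- r) inner (F i) g.
Proof.
move=> hg hF; elim: r => [|i r IH]; first by rewrite !big_nil inner0l.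
by rewrite !big_cons innerDl ?IH//; exact: L2_sum.
Qed.

(** The extended norm L2norm of a square-integrable function is finite, and
    this is its value. *)
Definition nrm f : R := Num.sqrt (\int[mu]_t absq (f t)).

Lemma nrm_ge0 f : 0 <= nrm f. Proof. exact: sqrtr_ge0. Qed.

Lemma sqr_nrm f : nrm f ^+ 2 = \int[mu]_t absq (f t).
Proof.
by rewrite sqr_sqrtr// Rintegral_ge0// => t _; exact: absq_ge0.
Qed.

Lemma inner_nrm f : inner f f = (nrm f ^+ 2)%:C.
Proof.
rewrite sqr_nrm /inner; congr Complex.
  by apply: eq_Rintegral => t _; rewrite -absq_mulJ.
transitivity (\int[mu]_t (0 : R)); last by rewrite Rintegral_cst// mul0r.
by apply: eq_Rintegral => t _; rewrite -absq_mulJ.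
Qed.

Lemma sqr_nrmE f : nrm f ^+ 2 = complex.Re (inner f f).
Proof. by rewrite inner_nrm. Qed.

Lemma L2norm_nrm f : L2 f -> L2norm f = (nrm f)%:E.
Proof.
move=> hf; rewrite L2normE -[X in (X `^ _)%E]fineK; last first.
  by apply: integrable_fin_num => //; exact: L2_integrable.
rewrite poweR_EFin powR12_sqrt// fine_ge0// integral_ge0// => t _.
by rewrite lee_fin absq_ge0.
Qed.

Lemma nrmD_sqr f g : L2 f -> L2 g ->
  nrm (f + g) ^+ 2 = nrm f ^+ 2 + nrm g ^+ 2 + 2 * complex.Re (inner f g).
Proof.
move=> hf hg; rewrite !sqr_nrmE innerDl ?innerDr//; last exact: L2D.
rewrite (innerC hf hg) !cReD.
case: (inner f g) => a b /=; ring.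
Qed.

Lemma normcR (t : R) : Normc.normc t%:C = `|t|.
Proof. by rewrite normc_sqrt /absq /= expr0n addr0 sqrtr_sqr. Qed.

Lemma nrmZ a f : L2 f -> nrm (a *: f) = Normc.normc a * nrm f.
Proof.
move=> hf; apply/eqP; rewrite -(eqrXn2 (n := 2))// ?nrm_ge0//; last first.
  by rewrite mulr_ge0 ?nrm_ge0// normc_sqrt sqrtr_ge0.
rewrite sqr_nrmE innerZl ?innerZr//; last exact: L2Z.
rewrite inner_nrm exprMn normc_sqrt (sqr_sqrtr (absq_ge0 a)).
rewrite mulrA -absq_mulJ cReM /=; apply/eqP; ring.
Qed.

(** The quadratic polynomial t |-> ||f + t g||^2 is nonnegative; the step is to
    evaluate it at its minimum, or far away when g has norm zero. *)
Lemma cauchy_schwarz_Re f g : L2 f -> L2 g ->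
  complex.Re (inner f g) <= nrm f * nrm g.
Proof.
move=> hf hg.
have H (t : R) : 0 <= nrm f ^+ 2 + t ^+ 2 * nrm g ^+ 2 + 2 * t * complex.Re (inner f g).
  have hg' := L2Z t%:C hg.
  have := nrmD_sqr hf hg'; rewrite innerZr// nrmZ// cReM normcR exprMn.
  rewrite (real_normK (num_real t)) [complex.Re _^*%C]/= [complex.Im _^*%C]/=.
  rewrite oppr0 mul0r subr0 mulrA => e.
  by have := sqr_ge0 (nrm (f + t%:C *: g)); rewrite e.
have a0 := nrm_ge0 f; have b0 := nrm_ge0 g.
move: H a0 b0; move: (nrm f) (nrm g) (complex.Re _) => a b c H a0 b0.
have [b_gt0|b_le0] := ltP 0 b.
  have := H (- (c / b ^+ 2)).
  have bn : b != 0 by rewrite gt_eqF.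
  rewrite (_ : _ + _ = a ^+ 2 - c ^+ 2 / b ^+ 2); last by field.
  rewrite subr_ge0 ler_pdivrMr ?exprn_gt0// -exprMn => le.
  rewrite leNgt; apply/negP => lt.
  have : (a * b) ^+ 2 < c ^+ 2 by rewrite ltrXn2r ?nnegrE ?mulr_ge0// (le_trans _ (ltW lt))// mulr_ge0.
  by rewrite ltNge le.
have -> : b = 0 by apply/eqP; rewrite eq_le b_le0.
rewrite mulr0 leNgt; apply/negP => c0.
have := H (- (a ^+ 2 + 1) / (2 * c)).
have -> : b = 0 by apply/eqP; rewrite eq_le b_le0.
rewrite expr0n mulr0 addr0.
rewrite (_ : _ + _ = -1); last by field; rewrite gt_eqF.
by rewrite oppr_ge0 leNgt ltr01.
Qed.

Lemma nrm_triangle f g : L2 f -> L2 g -> nrm (f + g) <= nrm f + nrm g.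
Proof.
move=> hf hg; rewrite -(ler_pXn2r (n := 2))// ?nnegrE ?addr_ge0 ?nrm_ge0//.
rewrite nrmD_sqr// sqrrD.
have := cauchy_schwarz_Re hf hg; lra.
Qed.

Lemma nrmN f : nrm (- f) = nrm f.
Proof.
rewrite /nrm; congr Num.sqrt; apply: eq_Rintegral => t _.
by rewrite /GRing.opp /=; case: (f t) => a b; rewrite /absq /= !sqrrN.
Qed.

Lemma nrmBC f g : nrm (f - g) = nrm (g - f).
Proof. by rewrite -nrmN opprB. Qed.

Lemma nrm_triangleB f g : L2 f -> L2 g -> nrm (f - g) <= nrm f + nrm g.
Proof. by move=> hf hg; rewrite -(nrmN g) nrm_triangle//; exact: L2N. Qed.

Lemma nrm_dist f g h : L2 f -> L2 g -> L2 h ->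
  nrm (f - h) <= nrm (f - g) + nrm (g - h).
Proof.
by move=> hf hg hh; rewrite -(subrKA g) nrm_triangle//; exact: L2B.
Qed.

Lemma inner_bound f g : L2 f -> L2 g ->
  `|complex.Re (inner f g)| <= nrm f * nrm g /\
  `|complex.Im (inner f g)| <= nrm f * nrm g.
Proof.
move=> hf hg.
have hr f' : L2 f' -> `|complex.Re (inner f' g)| <= nrm f' * nrm g.
  move=> hf'; rewrite ler_norml cauchy_schwarz_Re// andbT lerNl.
  have := cauchy_schwarz_Re (L2N hf') hg; rewrite innerNl// nrmN.
  by case: (inner f' g).
split; first exact: hr.
have := hr _ (L2Z 'i%C hf); rewrite innerZl// nrmZ// normc_sqrt /absq /=.
rewrite expr0n add0r expr1n sqrtr1 mul1r.
by case: (inner f g) => a b /=; rewrite mul0r mul1r sub0r normrN.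
Qed.

Lemma inner_nrm0 f g : L2 f -> L2 g -> nrm f = 0 -> inner f g = 0.
Proof.
move=> hf hg f0; have [] := inner_bound hf hg; rewrite f0 mul0r !normr_le0.
by case: (inner f g) => a b /= /eqP -> /eqP ->.
Qed.

Lemma circ_aeS (P Q : T -> Prop) : (forall t, P t -> Q t) ->
  (\forall t \ae mu, P t) -> (\forall t \ae mu, Q t).
Proof. move=> PQ; apply: (@filterS _ _ (ae_filter_ringOfSetsType mu)); exact: PQ. Qed.

(** A nonnegative function with integral zero vanishes almost everywhere. *)
Lemma ae_nrm f g : L2 f -> L2 g -> ae_equal f g <-> nrm (f - g) = 0.
Proof.
move=> hf hg; have hfg := L2B hf hg.
have ab : (\int[mu]_t `|(absq ((f - g) t))%:E|)%E = (nrm (f - g) ^+ 2)%:E.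
  rewrite sqr_nrm fineK; last first.
    by apply: integrable_fin_num => //; exact: L2_integrable.
  by apply: eq_integral => t _; rewrite gee0_abs// lee_fin absq_ge0.
have := @ae_eq_integral_abs _ _ _ mu setT measurableT (fun t => (absq ((f - g) t))%:E).
move=> /(_ _)[|H1 H2].
  apply/measurable_EFinP; exact: measurable_absq (L2_mfunC hfg).
have absq_eq0 t : absq ((f - g) t) = 0 -> f t = g t.
  rewrite [(f - g) t]/(f t - g t) => /eqP; rewrite /absq paddr_eq0 ?sqr_ge0//.
  rewrite !sqrf_eq0; case: (f t) (g t) => a b [c d] /=.
  by rewrite !subr_eq0 => /andP[/eqP -> /eqP ->].
split => [fg|fg].
  apply/eqP; rewrite -sqrf_eq0 -eqe -ab; apply/eqP; apply: H2.
  apply: circ_aeS fg => t /= h _; congr EFin.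
  have -> : (f - g) t = 0 by rewrite -[LHS]/(f t - g t) h// subrr.
  by rewrite /absq /= expr0n addr0.
have : ae_eq mu setT (fun t => (absq ((f - g) t))%:E) (cst 0%E).
  by apply: H1; rewrite ab fg expr0n.
by apply: circ_aeS => t /= h _; apply: absq_eq0; case: (h Logic.I).
Qed.

End Inner.

(** * Completeness *)

Lemma cvgn_summable_increments {R : realType} (x : nat -> R) :
  (\sum_(k <oo) (`|x k.+1 - x k|)%:E < +oo)%E -> cvgn x.
Proof.
move=> fin; have cs : cvgn (series (telescope x)).
  apply: normed_cvg; apply: nondecreasing_is_cvgn.
    by apply: nondecreasing_series => n _ _; exact: normr_ge0.
  exists (fine (\sum_(k <oo) (`|x k.+1 - x k|)%:E)) => _ [n _ <-].
  rewrite -lee_fin fineK; last first.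
    by rewrite ge0_fin_numE// nneseries_ge0// => k _ _; rewrite lee_fin.
  rewrite /series /= -sumEFin.
  by apply: (@nneseries_lim_ge _ (fun k => (`|x k.+1 - x k|)%:E)).
rewrite (_ : x = (fun n => x 0 + series (telescope x) n)); last first.
  by apply/funext => n; exact: eq_sum_telescope.
by apply: is_cvgD => //; exact: is_cvg_cst.
Qed.

(** A measurable choice of the limit: the upper limit exists at every point and is
    measurable, also where the sequence diverges. *)
Lemma cvgn_fine_limn_esup {R : realType} (x : nat -> R) :
  cvgn x -> x @ \oo --> fine (limn_esup (fun k => (x k)%:E)).
Proof.
move=> cx; have ce : (x n)%:E @[n --> \oo] --> (limn x)%:E.
  by apply: cvg_EFin; [exact: nearW|exact: cx].
rewrite is_cvg_limn_esupE; last by apply/cvg_ex; exists (limn x)%:E.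
by rewrite (cvg_lim _ ce).
Qed.

Section Complete.
Context {R : realType}.
Implicit Types (f g h : circfun R).
Local Notation mu := (@circle_measure R).
Local Notation T := (measurableTypeR R).
Notation rint F := (mu.-integrable setT (EFin \o (F : T -> R))).

Lemma abs_le_sq (a c : R) : 0 < c -> `|a| <= c + a ^+ 2 / (4 * c).
Proof.
move=> c0; have : 0 <= (`|a| - 2 * c) ^+ 2 / (4 * c).
  by rewrite divr_ge0 ?sqr_ge0// mulr_ge0// ltW.
rewrite -(real_normK (num_real a)) (_ : _ / _ = `|a| ^+ 2 / (4 * c) - `|a| + c).
  by lra.
by field; rewrite gt_eqF.
Qed.

(** By the arithmetic-geometric inequality the L^1 norm of an increment is at most
    a multiple of 2^-k, so the sum of all increments is integrable and therefore
    finite almost everywhere. *)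
Lemma ae_summable (v : nat -> circfun R) : (forall n, L2 (v n)) ->
  (forall k, nrm (v k.+1 - v k) <= 1 / (2 ^ k.+1)%:R) ->
  \forall t \ae mu, (\sum_(k <oo) (`|complex.Re (v k.+1 t) - complex.Re (v k t)|)%:E < +oo)%E
    /\ (\sum_(k <oo) (`|complex.Im (v k.+1 t) - complex.Im (v k t)|)%:E < +oo)%E.
Proof.
move=> hv hk.
pose d k (t : T) := `|complex.Re (v k.+1 t) - complex.Re (v k t)| +
           `|complex.Im (v k.+1 t) - complex.Im (v k t)|.
have md k : measurable_fun setT (d k).
  have [m1 m2] := L2_mfunC (hv k); have [m3 m4] := L2_mfunC (hv k.+1).
  by apply: measurable_funD; apply: measurableT_comp => //; exact: measurable_funB.
have d0 k t : 0 <= d k t by rewrite addr_ge0.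
pose G t := (\sum_(k <oo) (d k t)%:E)%E.
have mG : measurable_fun setT G.
  apply: ge0_emeasurable_sum => [k x _ _|k _]; first by rewrite lee_fin.
  exact/measurable_EFinP.
have G0 t : (0 <= G t)%E by apply: nneseries_ge0 => k _ _; rewrite lee_fin.
have iG : mu.-integrable setT G.
  apply/integrableP; split => //.
  under eq_integral do rewrite gee0_abs//.
  rewrite integral_nneseries//; last 2 first.
  - by move=> k; exact/measurable_EFinP.
  - by move=> k t _; rewrite lee_fin.
  apply: (@le_lt_trans _ _ (\sum_(k <oo) (3 / (2 ^ k.+1)%:R)%:E)%E); last first.
    by apply: (le_lt_trans (epsilon_trick0 xpredT _)); rewrite ?ltry.
  apply: lee_nneseries => [k _ _|k _].
    by apply: integral_ge0 => t _; rewrite lee_fin.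
  pose c : R := 1 / (2 ^ k.+1)%:R.
  have c0 : 0 < c by rewrite divr_gt0// ltr0n expn_gt0.
  have hd := L2B (hv k.+1) (hv k).
  have ib : rint (fun t => 2 * c + (4 * c)^-1 * absq ((v k.+1 - v k) t)).
    by apply: rintD; [exact: rint_cst|apply: rintZ; exact: L2_integrable].
  apply: (@le_trans _ _ (\int[mu]_t (2 * c + (4 * c)^-1 * absq ((v k.+1 - v k) t))%:E)%E).
    apply: ge0_le_integral => //.
    - by move=> t _; rewrite lee_fin.
    - exact/measurable_EFinP.
    - exact: (measurable_int mu ib).
    - move=> t _; rewrite lee_fin /absq.
      have -> : (v k.+1 - v k) t = v k.+1 t - v k t by [].
      rewrite /d; case: (v k.+1 t) (v k t) => a b [a' b'] /=.
      (* the inequality with weight c = 2^-(k+1), which balances the L^2 bound c^2 *)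
      have := abs_le_sq (a - a') c0; have := abs_le_sq (b - b') c0.
      rewrite mulrDr; lra.
  rewrite integralD_EFin//; last 2 first.
    exact: rint_cst.
    by apply: rintZ; exact: L2_integrable.
  rewrite integral_cst// circle_measureT mule1.
  under eq_integral do rewrite /= EFinM.
  rewrite integralZl//; last exact: L2_integrable.
  rewrite -[X in (_ * X)%E]fineK; last first.
    by apply: integrable_fin_num => //; exact: L2_integrable.
  have := sqr_nrm (v k.+1 - v k); rewrite /Rintegral => <-.
  rewrite -EFinM -EFinD lee_fin.
  have hn : nrm (v k.+1 - v k) ^+ 2 <= c ^+ 2.
    by rewrite lerXn2r ?nnegrE ?nrm_ge0// ?(ltW c0)// hk.
  have -> : 3 / (2 ^ k.+1)%:R = 3 * c by rewrite /c mul1r.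
  apply: (@le_trans _ _ (2 * c + (4 * c)^-1 * c ^+ 2)).
    by rewrite lerD2l ler_pM2l// invr_gt0 mulr_gt0.
  rewrite (_ : _ * c ^+ 2 = c / 4); first by lra.
  by field; rewrite gt_eqF.
apply: circ_aeS (integrable_ae measurableT iG) => t /(_ Logic.I).
rewrite ge0_fin_numE// => Gt; split; apply: le_lt_trans Gt; apply: lee_nneseries => k _ //.
  by rewrite lee_fin lerDl.
by rewrite lee_fin lerDr.
Qed.

(** Fatou's lemma for |w - v k|^2; the conclusion carries the integrability of the
    limit along with the bound. *)
Lemma L2_fatou (w h : circfun R) (v : nat -> circfun R) (e : R) :
  L2 w -> (forall n, L2 (v n)) -> (forall t, h (t + 2 * pi) = h t) -> mfunC h ->
  (\forall t \ae mu, complex.Re (v k t) @[k --> \oo] --> complex.Re (h t) /\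
                     complex.Im (v k t) @[k --> \oo] --> complex.Im (h t)) ->
  (\forall k \near \oo, nrm (w - v k) <= e) ->
  L2 (w - h) /\ nrm (w - h) <= e.
Proof.
move=> hw hv ph mh aecv ne.
have e0 : 0 <= e by near \oo => k; apply: le_trans (nrm_ge0 (w - v k)) _; near: k.
have mwh : mfunC (w - h).
  by rewrite -scaleN1r; apply: mfunCD; [exact: L2_mfunC|exact: mfunCZ].
pose F k (t : T) := (absq ((w - v k) t))%:E.
have mF k : measurable_fun setT (F k).
  by apply/measurable_EFinP; apply: measurable_absq; exact/L2_mfunC/L2B.
have F0 k t : setT t -> (0 <= F k t)%E by move=> _; rewrite lee_fin absq_ge0.
have := @fatou _ _ _ mu setT measurableT F mF F0.
have -> : (\int[mu]_t limn_einf (F^~ t) = \int[mu]_t (absq ((w - h) t))%:E)%E.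
  apply: ae_eq_integral => //.
  - rewrite (_ : (fun t => _) = (fun t => - limn_esup (fun k => - F k t))%E)//.
    apply: measurableT_comp => //; apply: measurable_fun_limn_esup => k.
    exact: measurableT_comp.
  - by apply/measurable_EFinP; exact: measurable_absq.
  - apply: circ_aeS aecv => t [cr ci] _.
    have cF : (F^~ t) @ \oo --> (absq ((w - h) t))%:E.
      apply: cvg_EFin; first exact: nearW.
      rewrite (_ : _ \o _ = (fun k => (complex.Re (w t) - complex.Re (v k t)) ^+ 2 +
            (complex.Im (w t) - complex.Im (v k t)) ^+ 2)); last first.
        apply/funext => k; rewrite /F /=.
        have -> : (w - v k) t = w t - v k t by [].
        by rewrite /absq; case: (w t) (v k t) => a b [].
      have -> : absq ((w - h) t) = (complex.Re (w t) - complex.Re (h t)) ^+ 2 +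
            (complex.Im (w t) - complex.Im (h t)) ^+ 2.
        have -> : (w - h) t = w t - h t by [].
        by rewrite /absq; case: (w t) (h t) => a b [].
      by apply: cvgD; rewrite expr2; apply: cvgM; apply: cvgB => //; exact: cvg_cst.
    rewrite is_cvg_limn_einfE; last by apply/cvg_ex; eexists; exact: cF.
    exact: (cvg_lim _ cF).
have intE k : (\int[mu]_x F k x)%E = (nrm (w - v k) ^+ 2)%:E.
  rewrite sqr_nrm fineK//; apply: integrable_fin_num => //.
  exact/L2_integrable/L2B.
have le_e : (limn_einf (fun k => \int[mu]_x F k x) <= (e ^+ 2)%:E)%E.
  rewrite limn_einf_lim; apply: lime_le; first exact: is_cvg_einfs.
  near=> n; apply: (@le_trans _ _ (\int[mu]_x F n x)%E).
    by apply: ereal_inf_lbound; exists n => /=.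
  rewrite intE lee_fin lerXn2r ?nnegrE ?nrm_ge0//; near: n.
  exact: ne.
move=> /le_trans /(_ le_e) le2.
have hwh : L2 (w - h).
  apply/L2P; split => //.
    move=> t; rewrite -[LHS]/(w (t + 2 * pi) - h (t + 2 * pi)) ph L2_period//.
  apply/integrableP; split; first by apply/measurable_EFinP; exact: measurable_absq.
  under eq_integral do rewrite gee0_abs ?lee_fin ?absq_ge0//.
  by apply: le_lt_trans le2 _; rewrite ltry.
split => //; rewrite -(ler_pXn2r (n := 2))// ?nnegrE ?nrm_ge0//.
rewrite sqr_nrm -lee_fin /Rintegral fineK//.
by apply: integrable_fin_num => //; exact: L2_integrable.
Unshelve. all: by end_near. Qed.

(** Riesz-Fischer: a subsequence with increments below 2^-k converges almost
    everywhere, and Fatou's lemma makes its pointwise limit the limit in norm. *)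
Theorem L2_complete (u : nat -> circfun R) : (forall n, L2 (u n)) ->
  (forall e, 0 < e -> exists N, forall n m, (N <= n)%N -> (N <= m)%N ->
     nrm (u n - u m) <= e) ->
  exists h, L2 h /\ nrm (u n - h) @[n --> \oo] --> (0 : R).
Proof.
move=> hu cau.
pose c k : R := 1 / (2 ^ k.+1)%:R.
have c0 k : 0 < c k by rewrite divr_gt0// ltr0n expn_gt0.
have /choice[N hN] : forall k, exists N, forall n m, (N <= n)%N -> (N <= m)%N ->
     nrm (u n - u m) <= c k by move=> k; exact: cau.
(* a monotone choice of indices beyond every N i *)
pose phi k := (\sum_(i < k.+1) N i + k)%N.
have phiS k : (phi k <= phi k.+1)%N.
  by rewrite /phi [in leqRHS]big_ord_recr/= -addnA leq_add2l addnS leqW// leq_addl.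
have phiN k : (N k <= phi k)%N by rewrite /phi big_ord_recr/= addnAC leq_addl.
have phi_mono i j : (i <= j)%N -> (phi i <= phi j)%N.
  by elim: j => [|j IH]; [rewrite leqn0 => /eqP ->|rewrite leq_eqVlt => /predU1P[->//|/IH/leq_trans]; apply].
pose v k := u (phi k).
have hv k : L2 (v k) by exact: hu.
have vS k : nrm (v k.+1 - v k) <= c k.
  by apply: hN => //; exact: leq_trans (phiN k) (phiS k).
pose h : circfun R := fun t => fine (limn_esup (fun k => (complex.Re (v k t))%:E)) +i*
   fine (limn_esup (fun k => (complex.Im (v k t))%:E)).
have ph t : h (t + 2 * pi) = h t.
  rewrite /h; congr (_ +i* _); congr (fine (limn_esup _)); apply/funext => k;
  by rewrite L2_period.
have mh : mfunC h.
  split; rewrite /h /=.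
    apply: (measurableT_comp (fine_measurable measurableT)).
    apply: measurable_fun_limn_esup => k; apply/measurable_EFinP.
    exact: (L2_mfunC (hv k)).1.
  apply: (measurableT_comp (fine_measurable measurableT)).
  apply: measurable_fun_limn_esup => k; apply/measurable_EFinP.
  exact: (L2_mfunC (hv k)).2.
have aecv : \forall t \ae mu, complex.Re (v k t) @[k --> \oo] --> complex.Re (h t) /\
                     complex.Im (v k t) @[k --> \oo] --> complex.Im (h t).
  apply: circ_aeS (ae_summable hv vS) => t [h1 h2].
  by split; apply: cvgn_fine_limn_esup; exact: cvgn_summable_increments.
have key e : 0 < e -> exists N, forall n, (N <= n)%N -> L2 (u n - h) /\ nrm (u n - h) <= e.
  move=> /cau[M hM]; exists M => n Mn; apply: (L2_fatou (v := v)) => //.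
  near=> k; apply: hM => //.
  apply: (@leq_trans k); last by rewrite leq_addl.
  by near: k; exact: nbhs_infty_ge.
have hh : L2 h.
  have [M hM] := key 1 ltr01; have [hMh _] := hM M (leqnn _).
  by rewrite -(subKr (u M) h); exact: L2B.
exists h; split => //; apply/cvgrPdist_le => e /key[M hM].
near=> n; rewrite sub0r normrN ger0_norm ?nrm_ge0//.
apply: (hM n _).2; near: n; exact: nbhs_infty_ge.
Unshelve. all: by end_near. Qed.

End Complete.

(** * The reflection *)

Lemma fin_numMBr {R : realType} (c : R) (x y : \bar R) : x \is a fin_num ->
  y \is a fin_num -> (c%:E * x - c%:E * y = c%:E * (x - y))%E.
Proof. by move=> /fineK <- /fineK <-; rewrite -!EFinM mulrBr. Qed.

Section CircleIntegral.
Context {R : realType}.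
Implicit Types (f g h : circfun R).
Local Notation mu := (@circle_measure R).
Local Notation T := (measurableTypeR R).
Local Notation leb := (@lebesgue_measure R).
Local Notation arc := (@Defs.arc R).
Notation rint F := (mu.-integrable setT (EFin \o (F : T -> R))).

(** The measure is carried by the arc [-pi, pi]. *)
Lemma ge0_integral_circle (F : T -> \bar R) : measurable_fun setT F ->
  (forall t, 0 <= F t)%E ->
  (\int[mu]_t F t = (2 * pi)^-1%:E * \int[leb]_(t in arc) F t)%E.
Proof.
move=> mF F0; rewrite /circle_measure ge0_integral_mscale//; congr (_ * _)%E.
have marc := @measurable_arc R.
have mC : measurable (~` arc : set T) by exact: measurableC.
rewrite (ge0_negligible_integral mC)//; last first.
  by rewrite -[LHS]/(leb (~` arc `&` arc)) setICl measure0.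
rewrite setDE setTI setCK; apply: eq_measure_integral => A mA /setIidl Aa.
by rewrite -[LHS]/(leb (A `&` arc)) Aa.
Qed.

Lemma pi2_gt0 : 0 < (2 * pi)^-1 :> R.
Proof. by rewrite invr_gt0 mulr_gt0// pi_gt0. Qed.

Lemma integrable_circle (F : T -> \bar R) : measurable_fun setT F ->
  mu.-integrable setT F <-> leb.-integrable arc F.
Proof.
move=> mF; have mF' : measurable_fun setT (fun t => `|F t|)%E by exact: measurableT_comp.
have e := ge0_integral_circle mF' (fun t => abse_ge0 _).
split=> /integrableP[_ h]; apply/integrableP; split => //.
- exact: measurable_funTS.
- move: h; rewrite e; case: (integral _ _ _) => [r||]//; first by rewrite !ltry.
  by rewrite mulry gtr0_sg ?pi2_gt0// mul1e.
- rewrite e; move: h.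
  have : (0 <= \int[leb]_(t in arc) `|F t|)%E by exact: integral_ge0.
  by case: (integral _ _ _) => [r||]//= _ _; rewrite -EFinM ltry.
Qed.

Lemma integral_circle (F : T -> \bar R) : mu.-integrable setT F ->
  (\int[mu]_t F t = (2 * pi)^-1%:E * \int[leb]_(t in arc) F t)%E.
Proof.
move=> iF; have mF := measurable_int mu iF.
have iL := (integrable_circle mF).1 iF.
rewrite integralE [in RHS]integralE.
rewrite (ge0_integral_circle (measurable_funepos mF)) => [|t]; last exact: funepos_ge0.
rewrite (ge0_integral_circle (measurable_funeneg mF)) => [|t]; last exact: funeneg_ge0.
have marc := @measurable_arc R.
have p := integrable_pos_fin_num marc iL.
have n := integrable_neg_fin_num marc iL.
exact: fin_numMBr.
Qed.

Lemma lebesgue_measure_reflect (c : R) (A : set T) : measurable A ->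
  leb ((fun t => c - t) @^-1` A) = leb A.
Proof.
move=> mA.
have mr : measurable_fun [set: T] (fun t : T => c - t : T).
  apply: measurable_funB; [exact: measurable_cst|exact: measurable_id].
pose m := pushforward leb (fun t : T => c - t : T).
apply/esym; rewrite -[RHS]/(m A).
apply: (@lebesgue_measure_unique R m) => //= _ [[a b]] _ <-.
rewrite /m /pushforward /=.
have -> : (fun t : T => c - t : T) @^-1` `]a, b]%classic = `[c - b, c - a[%classic.
  apply/seteqP; split => t /=; rewrite !in_itv/= => /andP[h1 h2]; apply/andP; split; lra.
rewrite !lebesgue_measure_itv/= !lte_fin.
by rewrite ltrD2l ltrN2; case: ifPn => // _; rewrite -!EFinB; congr EFin; lra.
Qed.

(** On [-pi, pi], the representative of pi - t that stays in [-pi, pi]: it agrees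
    with pi - t on periodic functions and preserves the measure. *)
Definition reflect_arc (t : T) : T := if 0 <= t then pi - t else - pi - t.

Lemma measurable_reflect_arc : measurable_fun setT reflect_arc.
Proof.
apply: measurable_fun_ifT => /=.
- apply: measurable_fun_ler; [exact: measurable_cst|exact: measurable_id].
- apply: measurable_funB; [exact: measurable_cst|exact: measurable_id].
- apply: measurable_funB; [exact: measurable_cst|exact: measurable_id].
Qed.

Lemma circle_measure_reflect (A : set T) : measurable A ->
  pushforward mu reflect_arc A = mu A.
Proof.
move=> mA; rewrite /pushforward !circle_measureE; congr (_ * _)%E.
have p0 := @pi_gt0 R.
have mI (i : interval R) (B : set T) : measurable B -> measurable (B `&` [set` i]).
  by move=> mB; exact: measurableI.
(* the two half arcs are reflected separately; they overlap or leave gaps only at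
   end points, which are null sets *)
have -> : reflect_arc @^-1` A `&` arc =
    (fun t => pi - t) @^-1` (A `&` `[0, pi]) `|`
    (fun t => - pi - t) @^-1` (A `&` `]- pi, 0]).
  apply/seteqP; split => t /=; rewrite /reflect_arc /Defs.arc /= !in_itv/=.
    case: ifPn => t0 [At /andP[h1 h2]]; [left|right]; split => //; apply/andP; split => //.
    - by rewrite subr_ge0.
    - by rewrite gerBl.
    - by move: t0; rewrite -ltNge; lra.
    - lra.
  move=> [[At /andP[h1 h2]]|[At /andP[h1 h2]]].
    by rewrite ifT; last lra; split => //; apply/andP; split; lra.
  rewrite ifF; last by apply/negbTE; rewrite -ltNge; lra.
  by split => //; apply/andP; split; lra.
have mr c : measurable_fun [set: T] (fun t : T => c - t : T).
  apply: measurable_funB; [exact: measurable_cst|exact: measurable_id].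
have mpre c B : measurable B -> measurable ((fun t : T => c - t : T) @^-1` B).
  by move=> mB; rewrite -(setTI (_ @^-1` _)); exact: mr.
rewrite measureU; last 3 first.
- by apply: mpre; exact: mI.
- by apply: mpre; exact: mI.
- apply/seteqP; split => // t /= [[_ +] [_ +]]; rewrite !in_itv/=.
  by move=> /andP[h1 h2] /andP[h3 h4]; lra.
transitivity (leb (A `&` `[0%R, pi]%classic) + leb (A `&` `](- pi)%R, 0%R]%classic))%E.
  by congr (_ + _)%E; apply: lebesgue_measure_reflect; exact: mI.
have N0 x : leb (A `&` [set x]) = 0%E.
  apply/eqP; rewrite -measure_le0 -(lebesgue_measure_set1 x).
  by apply: le_measure; rewrite ?inE//; exact: measurableI.
have N1 : leb (A `&` `]- pi, 0]) = leb (A `&` `]- pi, 0[).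
  rewrite -(@setUitv1 _ _ (BRight (- pi)) 0 true); last by rewrite bnd_simp; lra.
  rewrite setIUr; apply: measureU0; [exact: mI|exact: measurableI|exact: N0].
have N2 : leb (A `&` `[- pi, 0[) = leb (A `&` `]- pi, 0[).
  rewrite -(@setU1itv _ _ (BLeft 0) (- pi) false); last by rewrite bnd_simp; lra.
  rewrite setUC setIUr; apply: measureU0; [exact: mI|exact: measurableI|exact: N0].
rewrite N1 -N2 -measureU; [|exact: mI|exact: mI|]; last first.
  apply/seteqP; split => // t /= [[_ +] [_ +]]; rewrite !in_itv/=.
  by move=> /andP[h1 h2] /andP[h3 h4]; lra.
rewrite -setIUr; congr (leb (A `&` _)); apply/seteqP; split => t /=;
  rewrite /Defs.arc /= !in_itv/=.
  by move=> [/andP[h1 h2]|/andP[h1 h2]]; apply/andP; split; lra.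
move=> /andP[h1 h2]; case: (lerP 0 t) => t0; [left|right]; first by rewrite h2.
by rewrite h1.
Qed.

Lemma integral_reflect (F : T -> \bar R) : mu.-integrable setT F ->
  mu.-integrable setT (F \o reflect_arc) ->
  (\int[mu]_t F (reflect_arc t) = \int[mu]_t F t)%E.
Proof.
move=> iF iFr; have mF := measurable_int mu iF.
transitivity (\int[pushforward mu reflect_arc]_t F t)%E.
  by rewrite (integral_pushforward measurable_reflect_arc).
apply: eq_measure_integral => [|mphi A mA _]; first exact: measurable_reflect_arc.
exact: circle_measure_reflect.
Qed.

Lemma ge0_integral_reflect (F : T -> \bar R) : measurable_fun setT F ->
  (forall t, 0 <= F t)%E ->
  (\int[mu]_t F (reflect_arc t) = \int[mu]_t F t)%E.
Proof.
move=> mF F0.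
transitivity (\int[pushforward mu reflect_arc]_t F t)%E.
  by rewrite (ge0_integral_pushforward measurable_reflect_arc).
apply: eq_measure_integral => [|mphi A mA _]; first exact: measurable_reflect_arc.
exact: circle_measure_reflect.
Qed.

Lemma reflect_periodic (U : Type) (F : R -> U) : (forall t, F (t + 2 * pi) = F t) ->
  forall t, F (reflect_arc t) = F (pi - t).
Proof.
move=> pF t; rewrite /reflect_arc; case: ifPn => // _.
by rewrite -pF; congr F; lra.
Qed.

Lemma measurable_reflect d (U : measurableType d) (F : T -> U) :
  measurable_fun setT F -> measurable_fun setT (fun t : T => F (pi - t)).
Proof.
move=> mF; apply: measurableT_comp => //.
by apply: measurable_funB; [exact: measurable_cst|exact: measurable_id].
Qed.

Lemma L2_opR f : L2 f -> L2 (opR f).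
Proof.
move=> hf; have [mr mi] := L2_mfunC hf.
have mR : mfunC (opR f).
  by split; [exact: (measurable_reflect mr)|exact: (measurable_reflect mi)].
apply/L2P; split => //.
  by move=> t; rewrite /opR -(L2_period hf); congr f; lra.
apply/integrableP; split; first by apply/measurable_EFinP; exact: measurable_absq.
have /integrableP[mabs] := L2_integrable hf.
rewrite -ge0_integral_reflect//; last exact: measurableT_comp.
congr (_ < _)%E; apply: eq_integral => t _.
rewrite (@reflect_periodic _ (fun t => `|(absq (f t))%:E|%E))//.
by move=> x; rewrite (L2_period hf).
Qed.

Lemma Rintegral_reflect (F : R -> R) : (forall t, F (t + 2 * pi) = F t) ->
  rint F -> rint (fun t => F (pi - t)) ->
  \int[mu]_t F (pi - t) = \int[mu]_t F t.
Proof.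
move=> pF iF iFr; rewrite /Rintegral; congr fine.
rewrite -[RHS]integral_reflect//.
  by apply: eq_integral => t _; rewrite /= (reflect_periodic pF).
apply: eq_integrable iFr => // t _.
by rewrite /= (reflect_periodic pF).
Qed.

Lemma inner_opR f g : L2 f -> L2 g -> inner (opR f) (opR g) = inner f g.
Proof.
move=> hf hg; have [r i] := rint_inner hf hg.
have [r' i'] := rint_inner (L2_opR hf) (L2_opR hg).
rewrite /inner; congr Complex.
- apply: (@Rintegral_reflect (fun t => complex.Re (f t * (g t)^*%C))) => //.
  by move=> t; rewrite (L2_period hf) (L2_period hg).
- apply: (@Rintegral_reflect (fun t => complex.Im (f t * (g t)^*%C))) => //.
  by move=> t; rewrite (L2_period hf) (L2_period hg).
Qed.

Lemma opRK f : opR (opR f) = f.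
Proof. by apply/funext => t; rewrite /opR; congr f; lra. Qed.

Lemma opRD f g : opR (f + g) = opR f + opR g. Proof. by []. Qed.
Lemma opRZ (a : R[i]) f : opR (a *: f) = a *: opR f. Proof. by []. Qed.
Lemma nrm_opR f : L2 f -> nrm (opR f) = nrm f.
Proof.
move=> hf; apply/eqP; rewrite -(eqrXn2 (n := 2))// ?nrm_ge0//.
by rewrite !sqr_nrmE inner_opR.
Qed.

End CircleIntegral.

(** * Multiplication by the sign of the cosine, and the exponentials *)

Section SignMultiplication.
Context {R : realType}.
Implicit Types (f g h : circfun R).
Local Notation mu := (@circle_measure R).
Local Notation T := (measurableTypeR R).
Local Notation leb := (@lebesgue_measure R).
Local Notation arc := (@Defs.arc R).
Notation rint F := (mu.-integrable setT (EFin \o (F : T -> R))).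

Lemma cosD2piM (t : R) : cos (t + 2 * pi) = cos t.
Proof. by rewrite mulr_natl cosD2pi. Qed.

Lemma sinD2piM (t : R) : sin (t + 2 * pi) = sin t.
Proof. by rewrite mulr_natl sinD2pi. Qed.

Lemma mfunC_opM f : mfunC f -> mfunC (opM f).
Proof.
apply: (@mfunCM _ (fun t => (Num.sg (cos t))%:C)); split => /=; last exact: measurable_cst.
have mc : measurable_fun [set: T] (fun t : T => cos t : T).
  exact: continuous_measurable_fun (@continuous_cos R).
rewrite (_ : (fun t => _) = (fun t : T => if cos t == 0 then 0 else if cos t < 0 then -1 else 1 : T)).
  apply: measurable_fun_ifT => //.
    by apply: measurable_fun_eqr => //; exact: measurable_cst.
  apply: measurable_fun_ifT => //.
  by apply: measurable_fun_ltr => //; exact: measurable_cst.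
by apply/funext => t; rewrite /Num.sg.
Qed.

Lemma absq_opM_le f t : absq (opM f t) <= absq (f t).
Proof.
rewrite /opM absqM ler_piMl ?absq_ge0//.
by rewrite /absq /= expr0n addr0 sqr_sg; case: (cos t != 0) => //=; exact: ler01.
Qed.

Lemma L2_opM f : L2 f -> L2 (opM f).
Proof.
move=> hf; apply: (L2_dominated _ (mfunC_opM (L2_mfunC hf)) (L2_integrable hf)).
  by move=> t; rewrite /opM cosD2piM L2_period.
by move=> t; exact: absq_opM_le.
Qed.

Lemma opMD f g : opM (f + g) = opM f + opM g.
Proof. by apply/funext => t; rewrite /opM -[LHS]/(_ * (f t + g t)) mulrDr. Qed.

Lemma opMZ (a : R[i]) f : opM (a *: f) = a *: opM f.
Proof. by apply/funext => t; rewrite /opM -[LHS]/(_ * (a * f t)) mulrCA. Qed.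

Lemma opMN f : opM (- f) = - opM f.
Proof. by rewrite -scaleN1r opMZ scaleN1r. Qed.

Lemma opMB f g : opM (f - g) = opM f - opM g.
Proof. by rewrite opMD opMN. Qed.

Lemma opR_opM f : opR (opM f) = - opM (opR f).
Proof.
apply/funext => t; rewrite /opR /opM -[RHS]/(- (_ * f (pi - t))).
rewrite addrC cosDpi cosN sgrN rmorphN mulNr //.
Qed.

Lemma inner_opM f g : inner (opM f) g = inner f (opM g).
Proof.
rewrite /inner /opM; congr Complex; apply: eq_Rintegral => t _;
by case: (f t) (g t) => a b [c d] /=; ring.
Qed.

(** The sign of the cosine vanishes on a null set only, which is why M is an
    involution almost everywhere. *)
Lemma cos_eq0_arc (t : R) : - pi <= t <= pi -> cos t = 0 -> t = pi / 2 \/ t = - (pi / 2).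
Proof.
have p0 := @pi_gt0 R.
have H (s : R) : 0 <= s <= pi -> cos s = 0 -> s = pi / 2.
  move=> sp cs; apply: (@cos_inj R); rewrite ?in_itv//=; last by rewrite cs cos_pihalf.
  by apply/andP; split; lra.
move=> /andP[t1 t2] ct; have [t0|t0] := leP 0 t.
  by left; apply: H => //; rewrite t0.
right; rewrite -(H (- t)) ?opprK//; last by rewrite cosN.
by apply/andP; split; lra.
Qed.

(** M^2 = I holds off the two zeros of the cosine. *)
Lemma opMK f : L2 f -> nrm (opM (opM f) - f) = 0.
Proof.
move=> hf; apply/ae_nrm => //; [exact/L2_opM/L2_opM|].
exists ([set t : T | ~ arc t] `|` ([set pi / 2] `|` [set - (pi / 2)])).
have m1 (x : R) : measurable ([set x] : set T) by exact: measurable_set1.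
have m2 : measurable ([set t : T | ~ arc t]) by apply: measurableC; exact: measurable_arc.
split.
- by apply: measurableU => //; exact: measurableU.
- rewrite circle_measureE setIUl (_ : _ `&` arc = set0) ?set0U; last first.
    by apply/seteqP; split => // t [].
  rewrite (_ : leb _ = 0%E) ?mule0//.
  apply/eqP; rewrite -measure_le0.
  apply: (@le_trans _ _ (leb ([set pi / 2] `|` [set - (pi / 2)]))).
    apply: le_measure; rewrite ?inE//.
    + by apply: measurableI; [exact: measurableU|exact: measurable_arc].
    + exact: measurableU.
  have -> // : leb ([set pi / 2] `|` [set - (pi / 2)]) = 0%E.
  by rewrite measureU0//; exact: lebesgue_measure_set1.
- move=> t /= /not_implyP[_ nt].
  have [ta|] := pselect (arc t); last by left.
  right; apply: cos_eq0_arc => //; apply: contrapT => /eqP ct; apply: nt.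
  rewrite /opM mulrA -rmorphM -expr2 sqr_sg ct rmorph1 mul1r //.
Qed.

Lemma inner_opMM f g : L2 f -> L2 g -> inner (opM f) (opM g) = inner f g.
Proof.
move=> hf hg; rewrite -inner_opM; apply/eqP; rewrite -subr_eq0 -innerBl//.
  by rewrite inner_nrm0 ?opMK//; apply: L2B => //; exact/L2_opM/L2_opM.
exact/L2_opM/L2_opM.
Qed.

Lemma nrm_opM f : L2 f -> nrm (opM f) = nrm f.
Proof.
move=> hf; apply/eqP; rewrite -(eqrXn2 (n := 2))// ?nrm_ge0//.
by rewrite !sqr_nrmE inner_opMM.
Qed.

End SignMultiplication.

Section Exponentials.
Context {R : realType}.
Implicit Types (f g h : circfun R) (n m : int).
Local Notation mu := (@circle_measure R).
Local Notation T := (measurableTypeR R).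
Local Notation leb := (@lebesgue_measure R).
Local Notation arc := (@Defs.arc R).
Notation rint F := (mu.-integrable setT (EFin \o (F : T -> R))).
Local Notation expi := (@expi R).

Lemma expi0 : expi 0 = cst 1.
Proof. by apply/funext => t; rewrite /Defs.expi mul0r cos0 sin0. Qed.

Lemma expiD n m t : expi (n + m) t = expi n t * expi m t.
Proof.
by rewrite /Defs.expi intrD mulrDl cosD sinD; simpc; congr Complex; rewrite addrC [X in _ + X]mulrC mulrC.
Qed.

Lemma expiJ n t : (expi n t)^*%C = expi (- n) t.
Proof. by rewrite /Defs.expi /= mulrNz mulNr cosN sinN. Qed.

Lemma absq_expi n t : absq (expi n t) = 1.
Proof. by rewrite /absq /= cos2Dsin2. Qed.

Lemma expi_period n t : expi n (t + 2 * pi) = expi n t.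
Proof.
have e1 : expi 1 (t + 2 * pi) = expi 1 t.
  by rewrite /Defs.expi !mul1r cosD2piM sinD2piM.
have en (k : nat) : expi k (t + 2 * pi) = expi k t.
  elim: k => [|k IH]; first by rewrite expi0.
  by rewrite intS !expiD e1 IH.
case: n => k; first exact: en.
by rewrite NegzE -!expiJ en.
Qed.

Lemma measurable_cosM (c : R) : measurable_fun [set: T] (fun t : T => cos (c * t) : T).
Proof.
apply: (measurableT_comp (f := cos : T -> T)).
  exact: continuous_measurable_fun (@continuous_cos R).
by apply: measurable_funM; [exact: measurable_cst|exact: measurable_id].
Qed.

Lemma measurable_sinM (c : R) : measurable_fun [set: T] (fun t : T => sin (c * t) : T).
Proof.
apply: (measurableT_comp (f := sin : T -> T)).
  exact: continuous_measurable_fun (@continuous_sin R).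
by apply: measurable_funM; [exact: measurable_cst|exact: measurable_id].
Qed.

Lemma L2_expi n : L2 (expi n).
Proof.
apply: (@L2_bounded _ _ 1).
- by move=> t; rewrite expi_period.
- by split => /=; [exact: measurable_cosM|exact: measurable_sinM].
- by move=> t; rewrite absq_expi.
Qed.

(** A continuous periodic function with a periodic primitive has mean zero; this is
    where the orthogonality of the exponentials comes from. *)
Lemma Rintegral_circle_primitive (F F' : R -> R) : continuous F' ->
  (forall x : R, is_derive x 1 F (F' x)) -> F (- pi) = F pi ->
  rint F' -> \int[mu]_t F' t = 0.
Proof.
move=> cF' dF Fp iF; rewrite /Rintegral integral_circle//.
have cF : continuous F.
  by move=> x; apply: differentiable_continuous; apply/derivable1_diffP; exact: ex_derive.
rewrite (_ : integral _ _ _ = 0%E) ?mule0//.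
rewrite /Defs.arc (@continuous_FTC2 _ _ F).
- by rewrite Fp -EFinB subrr.
- by have := @pi_gt0 R; lra.
- by apply: continuous_in_subspaceT => x _; exact: cF'.
- split.
  + by move=> x _; exact: ex_derive.
  + by apply: cvg_at_right_filter; exact: cF.
  + by apply: cvg_at_left_filter; exact: cF.
- by move=> x _; rewrite derive1E; exact: derive_val.
Qed.

Lemma inner_expi m n : inner (expi m) (expi n) = (m == n)%:R.
Proof.
have [r i] := rint_inner (L2_expi m) (L2_expi n).
have e t : expi m t * (expi n t)^*%C = expi (m - n) t by rewrite expiJ expiD.
have [<-|mn] := eqVneq m n.
  rewrite inner_nrm sqr_nrm; under eq_Rintegral do rewrite absq_expi.
  by rewrite Rintegral_cst// circle_measureT mul1r.
pose k := m - n; have k0 : k%:~R != 0 :> R by rewrite intr_eq0 subr_eq0.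
have ek : expi k (- pi) = expi k pi.
  by rewrite -(expi_period k (- pi)); congr Defs.expi; lra.
have ckx (x : R) : is_derive x 1 (fun t : R => k%:~R * t) k%:~R.
  have := is_deriveZ (k%:~R : R) (is_derive_id x (1 : R)).
  by rewrite /GRing.scale /= mulr1.
have cM : continuous (fun t : R => k%:~R * t) by exact: mulrl_continuous.
rewrite /inner; congr Complex.
- under eq_Rintegral do rewrite e /=.
  apply: (@Rintegral_circle_primitive (fun t => (k%:~R)^-1 * sin (k%:~R * t))).
  + by move=> x; apply: continuous_comp; [exact: cM|exact: continuous_cos].
  + move=> x; apply: (@is_derive_eq _ _ _ _ _ _ _ _
      (is_deriveZ (k%:~R^-1) (is_derive1_comp (is_derive_sin _) (ckx x)))).
    by rewrite /GRing.scale /= mulrC mulfK.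
  + by case: ek => _ ->.
  + by apply: eq_integrable r => // t _; rewrite -[LHS]/(complex.Re (expi m t * (expi n t)^*%C))%:E e.
- under eq_Rintegral do rewrite e /=.
  apply: (@Rintegral_circle_primitive (fun t => - (k%:~R)^-1 * cos (k%:~R * t))).
  + by move=> x; apply: continuous_comp; [exact: cM|exact: continuous_sin].
  + move=> x; apply: (@is_derive_eq _ _ _ _ _ _ _ _
      (is_deriveZ (- k%:~R^-1) (is_derive1_comp (is_derive_cos _) (ckx x)))).
    by rewrite /GRing.scale /= mulrC mulrN mulfK// opprK.
  + by case: ek => -> _.
  + by apply: eq_integrable i => // t _; rewrite -[LHS]/(complex.Im (expi m t * (expi n t)^*%C))%:E e.
Qed.

End Exponentials.

(** * Completeness of the exponentials *)

Section StepApproximation.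
Context {R : realType}.
Implicit Types x y : R.

Lemma bernoulli_ge y n : 0 <= y -> 1 + n%:R * y <= (1 + y) ^+ n.
Proof.
move=> y0; elim: n => [|n IH]; first by rewrite mul0r addr0 expr0.
rewrite exprS; apply: (le_trans _ (ler_wpM2l _ IH)); last by rewrite addr_ge0.
rewrite -natr1; have : 0 <= n%:R * y * y by rewrite !mulr_ge0.
by move: (n%:R) => u; nra.
Qed.

Lemma bernoulli_le y n : 0 <= y <= 1 -> 1 - n%:R * y <= (1 - y) ^+ n.
Proof.
move=> /andP[y0 y1]; elim: n => [|n IH]; first by rewrite mul0r subr0 expr0.
rewrite exprS; apply: (le_trans _ (ler_wpM2l _ IH)); last by rewrite subr_ge0.
rewrite -natr1; have : 0 <= n%:R * y * y by rewrite !mulr_ge0.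
by move: (n%:R) => u; nra.
Qed.

(** A polynomial in x that tends to 1 for x < 1/2 and to 0 for x > 1/2, with values
    in [0, 1]: by the inequality of Bernoulli, (2x)^n decides the limit. *)
Definition step n x : R := (1 - x ^+ n) ^+ (2 ^ n).

Lemma step_itv n x : 0 <= x <= 1 -> 0 <= step n x <= 1.
Proof.
move=> /andP[x0 x1]; have xn0 := exprn_ge0 n x0; have xn1 := exprn_ile1 n x0 x1.
by rewrite /step exprn_ge0 ?exprn_ile1// ?subr_ge0// gerBl.
Qed.

Lemma cvg_step_lt x : 0 <= x < 2^-1 -> step n x @[n --> \oo] --> (1 : R).
Proof.
move=> /andP[x0 x2]; have x1 : 0 <= x <= 1 by apply/andP; split; lra.
apply: (@squeeze_cvgr _ _ _ _ (fun n => 1 - (2 * x) ^+ n) (cst 1)).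
- apply: nearW => n; have /andP[_ ->] := step_itv n x1; rewrite andbT.
  rewrite exprMn -natrX; apply: bernoulli_le.
  by case/andP: x1 => _ x1; rewrite exprn_ge0// exprn_ile1.
- rewrite -[X in _ --> X]subr0; apply: cvgB; first exact: cvg_cst.
  by apply: cvg_expr; rewrite ger0_norm; lra.
- exact: cvg_cst.
Qed.

Lemma cvg_step_gt x : 2^-1 < x <= 1 -> step n x @[n --> \oo] --> (0 : R).
Proof.
move=> /andP[x0 x2]; have x1 : 0 <= x <= 1 by apply/andP; split; lra.
apply: (@squeeze_cvgr _ _ _ _ (cst 0) (fun n => (2 * x)^-1 ^+ n)).
- apply: nearW => n; have /andP[-> _] := step_itv n x1 => /=.
  have p : 0 < (2 * x) ^+ n by rewrite exprn_gt0//; lra.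
  rewrite exprVn -[leRHS]mul1r ler_pdivlMr//.
  have yn : 0 <= x ^+ n <= 1.
    by case/andP: x1 => x1 x1'; rewrite exprn_ge0// exprn_ile1.
  case/andP: yn => y0 y1.
  (* (1 - y)^N (1 + y)^N <= 1 and (1 + y)^N >= N y, with y = x^n and N = 2^n *)
  apply: (@le_trans _ _ (step n x * (1 + x ^+ n) ^+ (2 ^ n))).
    rewrite ler_wpM2l//; first by case/andP: (step_itv n x1).
    apply: (le_trans _ (bernoulli_ge _ y0)).
    by rewrite exprMn -natrX lerDr.
  rewrite /step -exprMn -subr_sqr expr1n exprn_ile1//; last by rewrite gerBl sqr_ge0.
  by rewrite subr_ge0 exprn_ile1.
- exact: cvg_cst.
- by apply: cvg_expr; rewrite ger0_norm ?invr_ge0 ?invf_lt1; lra.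
Qed.

End StepApproximation.

Section Vanishing.
Context {R : realType}.
Implicit Types (f g h : circfun R) (c d : R).
Local Notation mu := (@circle_measure R).
Local Notation T := (measurableTypeR R).
Local Notation leb := (@lebesgue_measure R).
Local Notation arc := (@Defs.arc R).
Notation rint F := (mu.-integrable setT (EFin \o (F : T -> R))).
Local Notation expi := (@expi R).

(** Orthogonal to every exponential; the theorem below says that such a function is
    zero almost everywhere. *)
Definition vanishing f := L2 f /\ forall n, fourier f n = 0.

Lemma vanishingD f g : vanishing f -> vanishing g -> vanishing (f + g).
Proof.
move=> [hf zf] [hg zg]; split => [|n]; first exact: L2D.
by rewrite /fourier innerDl ?[inner _ _]zf ?[inner _ _]zg ?addr0//; exact: L2_expi.
Qed.

Lemma vanishingZ (a : R[i]) f : vanishing f -> vanishing (a *: f).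
Proof.
move=> [hf zf]; split => [|n]; first exact: L2Z.
by rewrite /fourier innerZl ?[inner _ _]zf ?mulr0//; exact: L2_expi.
Qed.

Lemma vanishing_expi m f : vanishing f -> vanishing (fun t => expi m t * f t).
Proof.
move=> [hf zf]; split => [|n].
  apply: (@L2_dominated _ _ (fun t => absq (f t))).
  - by move=> t; rewrite expi_period L2_period.
  - by apply: mfunCM; apply: L2_mfunC => //; exact: L2_expi.
  - exact: L2_integrable.
  - by move=> t; rewrite absqM absq_expi mul1r.
rewrite -[RHS](zf (n - m)) /fourier /inner.
have e t : expi m t * f t * (expi n t)^*%C = f t * (expi (n - m) t)^*%C.
  by rewrite !expiJ opprB expiD mulrA [f t * _]mulrC.
by congr Complex; apply: eq_Rintegral => t _; rewrite e.
Qed.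

(** A trigonometric polynomial with values in [0, 1] that is below 1/2 exactly on
    the arc of centre c and half-width d. *)
Definition well c d (t : R) : R := 2^-1 + cos d / 4 - cos (t - c) / 4.

Lemma well_itv c d t : 0 <= well c d t <= 1.
Proof.
rewrite /well; have := cos_le1 d; have := cos_geN1 d.
have := cos_le1 (t - c); have := cos_geN1 (t - c).
by move: (cos d) (cos (t - c)) => u v h1 h2 h3 h4; apply/andP; split; lra.
Qed.

(** The well is a combination of the exponentials of frequency -1, 0 and 1, and
    multiplication by an exponential only shifts the coefficients. *)
Lemma vanishing_well c d f : vanishing f ->
  vanishing (fun t => (well c d t)%:C * f t).
Proof.
move=> zf.
have -> : (fun t => (well c d t)%:C * f t) =
  (2^-1 + cos d / 4)%:C *: f +
  ((- (8^-1))%:C * expi 1 (- c)) *: (fun t => expi 1 t * f t) +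
  ((- (8^-1))%:C * expi 1 c) *: (fun t => expi (-1) t * f t) :> circfun R.
  apply/funext => t.
  rewrite -[RHS]/(_ * f t + _ * (_ * f t) + _ * (_ * f t)).
  rewrite !mulrA -!mulrDl; congr (_ * f t).
  rewrite /well /Defs.expi !mulrNz !mulNr !mul1r !sinN !cosN cosB.
  by simpc; congr Complex; field.
apply: vanishingD; [apply: vanishingD|]; apply: vanishingZ => //;
  exact: vanishing_expi.
Qed.

Lemma vanishing_step c d k f : vanishing f ->
  vanishing (fun t => (step k (well c d t))%:C * f t).
Proof.
move=> zf; rewrite /step; elim: (2 ^ k)%N => [|j IH].
  rewrite (_ : (fun t => _) = f)//; apply/funext => t.
  by rewrite expr0 mul1r.
rewrite (_ : (fun t => _) = (fun t => ((1 - well c d t ^+ k) ^+ j)%:C * f t) +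
  (-1) *: (fun t => (well c d t ^+ k)%:C * ((1 - well c d t ^+ k) ^+ j)%:C * f t)); last first.
  apply/funext => t; rewrite -[RHS]/(_ * f t + -1 * (_ * _ * f t)).
  by rewrite mulN1r -mulrBl; congr (_ * f t); rewrite exprS mulrBl mul1r rmorphB rmorphM.
apply: vanishingD => //; apply: vanishingZ.
suff H i : vanishing (fun t => (well c d t ^+ i)%:C * ((1 - well c d t ^+ k) ^+ j)%:C * f t).
  exact: H.
elim: i => [|i IHi].
  rewrite (_ : (fun t => _) = (fun t => ((1 - well c d t ^+ k) ^+ j)%:C * f t))//.
  by apply/funext => t; rewrite expr0 mul1r.
rewrite (_ : (fun t => _) = (fun t => (well c d t)%:C *
   ((well c d t ^+ i)%:C * ((1 - well c d t ^+ k) ^+ j)%:C * f t))); last first.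
  by apply/funext => t; rewrite exprS rmorphM !mulrA.
exact: vanishing_well.
Qed.

Lemma well_lt c d (t : R) : 0 < d -> - pi < c - d -> c + d < pi ->
  - pi <= t <= pi -> `|t - c| < d -> well c d t < 2^-1.
Proof.
move=> d0 h1 h2 /andP[t1 t2] tc; have p0 := @pi_gt0 R; have n0 := normr_ge0 (t - c).
have : cos d < cos (t - c).
  by rewrite -(cos_norm (t - c)) ltr_cos// in_itv/=; apply/andP; split; lra.
rewrite /well; lra.
Qed.

Lemma well_gt c d (t : R) : 0 < d -> - pi < c - d -> c + d < pi ->
  - pi <= t <= pi -> d < `|t - c| -> 2^-1 < well c d t.
Proof.
move=> d0 h1 h2 /andP[t1 t2] tc; have p0 := @pi_gt0 R; have n0 := normr_ge0 (t - c).
have tc2 : `|t - c| < 2 * pi - d by rewrite ltr_norml; apply/andP; split; lra.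
suff : cos (t - c) < cos d by rewrite /well; lra.
rewrite -(cos_norm (t - c)); have [le|lt] := leP `|t - c| pi.
  by rewrite ltr_cos// in_itv/=; apply/andP; split; lra.
rewrite -(cosN `|t - c|) -cosD2piM.
by rewrite ltr_cos ?in_itv/=; [lra|apply/andP; split; lra..].
Qed.

Lemma ae_neq (x : R) : \forall t \ae mu, t != x.
Proof.
exists [set x]; split; first exact: measurable_set1.
  rewrite circle_measureE (_ : leb _ = 0%E) ?mule0//.
  apply/eqP; rewrite -measure_le0.
  rewrite -[leRHS](lebesgue_measure_set1 x).
  apply: le_measure; rewrite ?inE//; first by apply: measurableI; [exact: measurable_set1|exact: measurable_arc].
by move=> t /= /negP; rewrite negbK => /eqP.
Qed.

Lemma ae_arc : \forall t \ae mu, arc t.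
Proof.
exists (~` arc); split => //; first by apply: measurableC; exact: measurable_arc.
by rewrite circle_measureE setICl measure0 mule0.
Qed.

Lemma rint_Re f : L2 f -> rint (fun t => complex.Re (f t)).
Proof.
move=> hf; apply: (@rint_le _ _ (fun t => 1 + absq (f t))).
- exact: (L2_mfunC hf).1.
- by apply: rintD; [exact: rint_cst|exact: L2_integrable].
- move=> t; case: (f t) => a b; rewrite /absq /= ler_norml; apply/andP; split.
    by have := sqr_ge0 (a + 1); have := sqr_ge0 b; nra.
  by have := sqr_ge0 (a - 1); have := sqr_ge0 b; nra.
Qed.

(** The products of f with the steps of a well have mean zero, are dominated by
    |f|, and converge to f on the arc and to 0 off its closure. *)
Lemma integral_vanishing_arc f c d : vanishing f -> 0 < d ->
  - pi < c - d -> c + d < pi ->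
  (\int[leb]_(t in ball c d) (complex.Re (f t))%:E = 0)%E.
Proof.
move=> zf d0 h1 h2; have [hf _] := zf; have p0 := @pi_gt0 R.
pose u := (fun t : T => (complex.Re (f t))%:E).
pose un (n : nat) (t : T) := (complex.Re ((step n (well c d t))%:C * f t))%:E.
have iu : mu.-integrable setT u by exact: rint_Re.
have mball : measurable (ball c d : set T) by exact: measurable_ball.
have un0 (n : nat) : (\int[mu]_t un n t = 0)%E.
  have [hn zn] := vanishing_step c d n zf.
  have iun := rint_Re hn.
  have := zn 0; rewrite /fourier /inner expi0 => -[+ _].
  rewrite /Rintegral (eq_integral (un n)) => [|t _]; last first.
    by rewrite oppr0 -[X in _ * X]/(1 : R[i]) mulr1.
  by move=> h; rewrite -[LHS]fineK ?h//; exact: integrable_fin_num.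
have [|||||iF _ +] := @dominated_convergence _ _ _ mu setT measurableT un
    (u \_ (ball c d)) (fun t => `|u t|)%E.
- by move=> n; have [hn _] := vanishing_step c d n zf; exact: (measurable_int mu (rint_Re hn)).
- apply/(measurable_restrictT _ _).1 => //; apply: measurable_funTS.
  exact: (measurable_int mu iu).
- have F1 := ae_filter_ringOfSetsType mu.
  have := @filterI _ _ F1 _ _ (ae_neq (c + d)) (@filterI _ _ F1 _ _ (ae_neq (c - d)) ae_arc).
  apply: circ_aeS => t [tcd [tcd' ta]] _.
  have -> : (u \_ (ball c d)) t = (\1_(ball c d) t * complex.Re (f t))%:E.
    by rewrite /patch indicE; case: ifP => _; rewrite ?mul1r ?mul0r.
  apply: cvg_EFin; first exact: nearW.
  have ta' : - pi <= t <= pi by move: ta; rewrite /Defs.arc /= in_itv.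
  have -> : fine \o (un ^~ t) = (fun n => step n (well c d t) * complex.Re (f t)).
    by apply/funext => n; rewrite /un /=; case: (f t) => a b /=; rewrite mul0r subr0.
  apply: cvgM; last exact: cvg_cst.
  have tc : `|t - c| != d.
    apply/eqP => e; have [h|h] := leP 0 (t - c).
      by move/eqP: tcd; apply; rewrite -e ger0_norm//; lra.
    by move/eqP: tcd'; apply; rewrite -e ltr0_norm//; lra.
  rewrite indicE; have [lt|ge] := ltP `|t - c| d.
    rewrite mem_set; last by rewrite -ball_normE /ball_ /= distrC.
    apply: cvg_step_lt; rewrite (well_lt d0)// andbT.
    by case/andP: (well_itv c d t).
  rewrite memNset; last by rewrite -ball_normE /ball_ /= distrC; apply/negP; rewrite -leNgt.
  apply: cvg_step_gt; rewrite (well_gt d0)//=.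
    by case/andP: (well_itv c d t).
  by rewrite lt_neqAle eq_sym tc.
- exact: integrable_abse.
- apply: nearW => t n _; rewrite /un /u !abse_EFin lee_fin.
  have /andP[s0 s1] := step_itv n (well_itv c d t).
  case: (f t) => a b /=; rewrite mul0r subr0 normrM ger0_norm// ler_piMl//.
rewrite (_ : [sequence _]_n = cst 0%E); last by apply/funext => n; rewrite /= un0.
move=> /(cvg_unique _ (cvg_cst _)) /= /(_ (@ereal_hausdorff R)).
rewrite integral_circle// -integral_mkcondr.
rewrite (_ : arc `&` ball c d = ball c d); last first.
  apply/setIidPr => t; rewrite -ball_normE /ball_ /= ltr_norml => /andP[t1 t2].
  by rewrite /Defs.arc /= in_itv/=; apply/andP; split; lra.
move=> /esym/eqP; rewrite mule_eq0 => /orP[/eqP[e]|/eqP//].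
by have := @pi2_gt0 R; rewrite e ltxx.
Qed.

Lemma lebesgue_ae_circle (P : T -> Prop) :
  (\forall t \ae leb, P t) -> \forall t \ae mu, P t.
Proof.
move=> [N [mN N0 PN]]; exists N; split => //.
rewrite circle_measureE (_ : leb _ = 0%E) ?mule0//.
apply/eqP; rewrite -measure_le0 -[leRHS]N0.
apply: le_measure; rewrite ?inE//; apply: measurableI => //.
exact: measurable_arc.
Qed.

(** At a Lebesgue point the averages over small arcs, which are zero, converge to
    the value. *)
Lemma lebesgue_pt_vanishing f (c : R) : vanishing f -> - pi < c < pi ->
  lebesgue_pt ((fun t => complex.Re (f t)) \_ arc) c -> complex.Re (f c) = 0.
Proof.
move=> zf /andP[c1 c2] lc; set U := _ \_ _ in lc; have [hf _] := zf.
have arcc : arc c by rewrite /Defs.arc /= in_itv/= !ltW.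
have Uarc t : arc t -> U t = complex.Re (f t) by move=> ta; rewrite /U patchE mem_set.
apply: contrapT => /eqP fc0; pose a := `|complex.Re (f c)|.
have a0 : 0 < a by rewrite normr_gt0.
suff : (a%:E <= 0)%E by rewrite lee_fin leNgt a0.
rewrite -(cvg_lim _ lc)//; apply: lime_ge; first by apply/cvg_ex; exists 0%E.
have d0 : 0 < Num.min (pi - c) (c + pi) by rewrite lt_min; apply/andP; split; lra.
near=> r.
have r0 : 0 < r by near: r; exact: nbhs_right_gt.
have : r < Num.min (pi - c) (c + pi) by near: r; exact: nbhs_right_lt.
rewrite lt_min => /andP[r1 r2].
have mball : measurable (ball c r : set T) by exact: measurable_ball.
have ballarc t : ball c r t -> arc t.
  rewrite -ball_normE /ball_ /= distrC ltr_norml => /andP[t1 t2].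
  by rewrite /Defs.arc /= in_itv/=; apply/andP; split; lra.
have ball2 : leb (ball c r) = (r *+ 2)%:E by rewrite lebesgue_measure_ball// ltW.
have iRe : leb.-integrable (ball c r) (EFin \o (fun t : T => complex.Re (f t))).
  apply: (@integrableS _ _ _ leb arc) => //; first exact: measurable_arc.
  apply/integrable_circle; last exact: rint_Re.
  by apply/measurable_EFinP; exact: (L2_mfunC hf).1.
have icst : leb.-integrable (ball c r) (EFin \o (fun _ : T => complex.Re (f c))).
  apply/integrableP; split; first by apply/measurable_EFinP; exact: measurable_cst.
  rewrite (_ : (fun x => _) = cst (a%:E)); last by apply/funext.
  by rewrite integral_cst// -[X in (_ * X)%E]/(leb (ball c r)) ball2 -EFinM ltry.
have r2n : r *+ 2 != 0 by rewrite mulrn_eq0 /= gt_eqF.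
rewrite /davg /iavg ball2 inver (negbTE r2n).
rewrite -[leLHS]mul1e -(mulVf r2n) EFinM -muleA.
apply: lee_wpmul2l; first by rewrite lee_fin invr_ge0 mulrn_wge0// ltW.
rewrite [leRHS](_ : _ = \int[leb]_(t in ball c r) `|(complex.Re (f t))%:E - (complex.Re (f c))%:E|)%E; last first.
  by apply: eq_integral => t /set_mem /ballarc ta; rewrite /= !Uarc.
apply: (@le_trans _ _ `|\int[leb]_(t in ball c r) ((complex.Re (f t))%:E - (complex.Re (f c))%:E)|%E); last first.
  apply: le_abse_integral => //; apply: emeasurable_funB.
    exact: (measurable_int leb iRe).
  exact: (measurable_int leb icst).
rewrite integralB_EFin// integral_vanishing_arc//; [|lra|lra].
rewrite sub0e abseN (integral_cst _ mball) -[X in (_ <= `|X|)%E]/((complex.Re (f c))%:E * leb (ball c r))%E ball2 abseM.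
by rewrite muleC /= (@ger0_norm _ (r *+ 2))// mulrn_wge0// ltW.
Unshelve. all: by end_near. Qed.

Lemma vanishing_Re f : vanishing f -> \forall t \ae mu, complex.Re (f t) = 0.
Proof.
move=> zf; have [hf _] := zf.
have F1 := ae_filter_ringOfSetsType mu.
have lint : locally_integrable setT ((fun t => complex.Re (f t)) \_ arc).
  apply: integrable_locally_restrict; first exact: measurable_arc.
  apply/integrable_circle; last exact: rint_Re.
  by apply/measurable_EFinP; exact: (L2_mfunC hf).1.
have h1 := lebesgue_ae_circle (lebesgue_differentiation lint).
have := @filterI _ _ F1 _ _ (@filterI _ _ F1 _ _ h1 ae_arc)
  (@filterI _ _ F1 _ _ (ae_neq (- pi)) (ae_neq pi)).
apply: circ_aeS => t [[lt ta] [n1 n2]]; apply: lebesgue_pt_vanishing => //.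
move: ta; rewrite /Defs.arc /= in_itv/= => /andP[t1 t2].
by rewrite !lt_neqAle t1 t2 n2 eq_sym n1.
Qed.

(** The real part of f and that of -i f vanish almost everywhere. *)
Theorem vanishing_ae0 f : vanishing f -> nrm f = 0.
Proof.
move=> zf; have [hf _] := zf; have F1 := ae_filter_ringOfSetsType mu.
have h1 := vanishing_Re zf.
have h2 := vanishing_Re (vanishingZ (- 'i%C) zf).
rewrite -[f]subr0; apply/ae_nrm => //.
have := @filterI _ _ F1 _ _ h1 h2.
apply: circ_aeS => t /= [e1 e2] _.
rewrite -[RHS]/(0 +i* 0).
move: e2; rewrite -[X in complex.Re X]/(- 'i%C * f t).
by move: e1; case: (f t) => a b /= -> ; rewrite mulr0 sub0r mulN1r opprK => ->.
Qed.

Corollary fourier_inj f g : L2 f -> L2 g -> fourier f = fourier g -> nrm (f - g) = 0.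
Proof.
move=> hf hg e; apply: vanishing_ae0; split => [|n]; first exact: L2B.
by rewrite /fourier (innerBl hf hg (L2_expi n)) -[inner f _]/(fourier f n) e subrr.
Qed.

End Vanishing.

(** * Limits, Fourier coefficients and multipliers *)

Arguments inner : simpl never.

Section Limits.
Context {R : realType}.
Implicit Types (f g h : circfun R) (u v : nat -> circfun R).

Definition ncvg u h := nrm (u n - h) @[n --> \oo] --> (0 : R).

Lemma L2cvgE u h : (forall n, L2 (u n)) -> L2 h -> L2cvg u h <-> ncvg u h.
Proof.
move=> hu hh; rewrite /L2cvg /ncvg.
rewrite (_ : (fun n => _) = (fun n => (nrm (u n - h))%:E)); last first.
  by apply/funext => n; rewrite L2norm_nrm//; exact: L2B.
split => [/fine_cvgP[_] //|c].
by apply: cvg_EFin; [exact: nearW|exact: c].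
Qed.

Lemma ncvgP u h : ncvg u h <->
  forall e, 0 < e -> exists N, forall n, (N <= n)%N -> nrm (u n - h) <= e.
Proof.
split => [/cvgrPdist_le c e /c[N _ hN]|c].
  exists N => n Nn; have := hN n Nn.
  by rewrite /= sub0r normrN ger0_norm// nrm_ge0.
apply/cvgrPdist_le => e /c[N hN]; near=> n.
rewrite sub0r normrN ger0_norm ?nrm_ge0//; apply: hN; near: n.
exact: nbhs_infty_ge.
Unshelve. all: by end_near. Qed.

Lemma ncvg_unique u h g : (forall n, L2 (u n)) -> L2 h -> L2 g ->
  ncvg u h -> ncvg u g -> nrm (h - g) = 0.
Proof.
move=> hu hh hg /ncvgP ch /ncvgP cg; apply/eqP; rewrite eq_le nrm_ge0 andbT.
apply/ler_addgt0Pr => e e0; have e2 : 0 < e / 2 by rewrite divr_gt0.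
have [N hN] := ch _ e2; have [M hM] := cg _ e2.
have := hN _ (leq_addr M N); have := hM _ (leq_addl N M).
have := nrm_dist hh (hu (N + M)%N) hg; rewrite (nrmBC h (u _)); lra.
Qed.

Lemma nrm_lim_le u h B : (forall n, L2 (u n)) -> L2 h -> ncvg u h ->
  (forall n, nrm (u n) <= B) -> nrm h <= B.
Proof.
move=> hu hh /ncvgP ch hB; apply/ler_addgt0Pr => e e0.
have [N hN] := ch _ e0; have := hN _ (leqnn N); have := hB N.
have := nrm_triangleB (hu N) (L2B (hu N) hh); rewrite subKr; lra.
Qed.

Lemma inner_cvg u h g : (forall n, L2 (u n)) -> L2 h -> L2 g -> ncvg u h ->
  complex.Re (inner (u n) g) @[n --> \oo] --> complex.Re (inner h g) /\
  complex.Im (inner (u n) g) @[n --> \oo] --> complex.Im (inner h g).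
Proof.
move=> hu hh hg cu.
have c0 : nrm (u n - h) * nrm g @[n --> \oo] --> (0 : R).
  by rewrite -[X in _ --> X](mul0r (nrm g)); apply: cvgM => //; exact: cvg_cst.
have e n : inner (u n - h) g = inner (u n) g - inner h g by rewrite innerBl.
split; apply/subr_cvg0; apply/norm_cvg0P;
  apply: (@squeeze_cvgr _ _ _ _ (cst 0) (fun n => nrm (u n - h) * nrm g)) => //;
  try exact: cvg_cst; apply: nearW => n; rewrite normr_ge0 andTb.
  have [+ _] := inner_bound (L2B (hu n) hh) hg.
  by rewrite e; case: (inner _ _) (inner _ _) => a b [].
have [_ +] := inner_bound (L2B (hu n) hh) hg.
by rewrite e; case: (inner _ _) (inner _ _) => a b [].
Qed.

Lemma inner_lim_near u h g c : (forall n, L2 (u n)) -> L2 h -> L2 g -> ncvg u h ->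
  (\forall n \near \oo, inner (u n) g = c) -> inner h g = c.
Proof.
move=> hu hh hg cu ec; have [cr ci] := inner_cvg hu hh hg cu.
have hr : complex.Re (inner h g) = complex.Re c.
  rewrite -(cvg_lim _ cr)//; apply: cvg_lim => //; apply: cvg_near_cst.
  by apply: filterS ec => n ->.
have hi : complex.Im (inner h g) = complex.Im c.
  rewrite -(cvg_lim _ ci)//; apply: cvg_lim => //; apply: cvg_near_cst.
  by apply: filterS ec => n ->.
by case: (inner h g) c hr hi {ec} => a b [a' b'] /= -> ->.
Qed.

(** Orthogonal expansions satisfy this with A n the sum of the squares of the first
    n coefficients: the Cauchy criterion is then that of a bounded monotone
    sequence of reals. *)
Lemma L2_cvg_bounded_increments u (A : nat -> R) B : (forall n, L2 (u n)) ->
  (forall n, A n <= B) ->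
  (forall m n, (m <= n)%N -> nrm (u n - u m) ^+ 2 <= A n - A m) ->
  exists h, L2 h /\ ncvg u h.
Proof.
move=> hu AB uA.
have ndA : nondecreasing_seq A.
  by move=> m n mn; rewrite -subr_ge0 (le_trans _ (uA m n mn))// sqr_ge0.
have /cvgrPdist_le cA : A @ \oo --> limn A.
  by apply: nondecreasing_is_cvgn => //; exists B => _ [n _ <-].
apply: L2_complete => // e e0.
have e2 : 0 < e ^+ 2 / 2 by rewrite divr_gt0 ?exprn_gt0.
have [N _ hN] := cA _ e2; exists N.
have key n m : (N <= m)%N -> (m <= n)%N -> nrm (u n - u m) <= e.
  move=> Nm mn; rewrite -(ler_pXn2r (n := 2))// ?nnegrE ?nrm_ge0 ?(ltW e0)//.
  apply: (le_trans (uA _ _ mn)).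
  have := hN m Nm; have := hN n (leq_trans Nm mn).
  by rewrite /= !ler_norml => /andP[h1 h2] /andP[h3 h4]; lra.
move=> n m Nn Nm; have [mn|nm] := leqP m n; first exact: key.
by rewrite nrmBC; apply: key => //; exact: ltnW.
Qed.

End Limits.

Section FourierCoefficients.
Context {R : realType}.
Implicit Types (f g h : circfun R) (n m j k : int).
Local Notation expi := (@expi R).

Lemma fourierD f g n : L2 f -> L2 g -> fourier (f + g) n = fourier f n + fourier g n.
Proof. by move=> hf hg; rewrite /fourier innerDl//; exact: L2_expi. Qed.

Lemma fourierZ a f n : L2 f -> fourier (a *: f) n = a * fourier f n.
Proof. by move=> hf; rewrite /fourier innerZl//; exact: L2_expi. Qed.

Lemma fourierN f n : L2 f -> fourier (- f) n = - fourier f n.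
Proof. by move=> hf; rewrite /fourier innerNl//; exact: L2_expi. Qed.

Lemma fourierB f g n : L2 f -> L2 g -> fourier (f - g) n = fourier f n - fourier g n.
Proof. by move=> hf hg; rewrite /fourier innerBl//; exact: L2_expi. Qed.

Lemma nrm0_fourier f g : L2 f -> L2 g -> nrm (f - g) = 0 <-> fourier f = fourier g.
Proof.
move=> hf hg; split; last exact: fourier_inj.
move=> e; apply/funext => n; apply/eqP; rewrite -subr_eq0 -fourierB//.
by rewrite /fourier inner_nrm0//; [exact: L2B|exact: L2_expi].
Qed.

(** All later identities between functions are proved on coefficients and brought
    back through this equivalence. *)
Lemma ae_fourier f g : L2 f -> L2 g -> ae_equal f g <-> fourier f = fourier g.
Proof.
by move=> hf hg; split => [/ae_nrm h|h];
  [apply/nrm0_fourier => //; exact: h|apply/ae_nrm => //; exact/nrm0_fourier].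
Qed.

Lemma fourier_expi m n : fourier (expi m) n = (m == n)%:R.
Proof. exact: inner_expi. Qed.

Lemma fourier_opR f n : L2 f ->
  fourier (opR f) n = (expi n pi)^*%C * fourier f (- n).
Proof.
move=> hf; rewrite /fourier -[in LHS](opRK (expi n)) inner_opR//; last exact/L2_opR/L2_expi.
have -> : opR (expi n) = expi n pi *: expi (- n).
  apply/funext => t; rewrite /opR -[RHS]/(_ * _).
  by rewrite /Defs.expi mulrBr mulrNz mulNr cosB sinB cosN sinN; simpc; congr Complex; ring.
by rewrite innerZr//; exact: L2_expi.
Qed.

(** M is no multiplier, so equality of coefficients passes through M only because it
    means equality almost everywhere. *)
Lemma opM_congr f g : L2 f -> L2 g -> fourier f = fourier g ->
  fourier (opM f) = fourier (opM g).
Proof.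
move=> hf hg /(nrm0_fourier hf hg) e; apply/nrm0_fourier; [exact: L2_opM..|].
by rewrite -opMB nrm_opM//; exact: L2B.
Qed.

(** The sums over |n| <= N that define a multiplier. *)
Definition symsum (V : zmodType) (F : int -> V) (N : nat) : V :=
  \sum_(m < N.*2.+1) F (m%:Z - N%:Z).

Lemma symsumS (V : zmodType) (F : int -> V) N :
  symsum F N.+1 = F (- N.+1%:Z) + symsum F N + F N.+1%:Z.
Proof.
rewrite /symsum doubleS big_ord_recl big_ord_recr /= addrA; congr (_ + _ + _).
- by congr F; lia.
- by apply: eq_bigr => i _; congr F; rewrite /bump /=; lia.
- by congr F; rewrite /bump /=; lia.
Qed.

Lemma symsum_trunc (V : zmodType) (F : int -> V) (M N : nat) : (M <= N)%N ->
  (forall j, (M < `|j|)%N -> F j = 0) -> symsum F N = symsum F M.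
Proof.
move=> MN F0; elim: N MN => [|N IH]; first by rewrite leqn0 => /eqP ->.
rewrite leq_eqVlt => /predU1P[->//|]; rewrite ltnS => MN.
by rewrite symsumS IH// !F0 ?add0r ?addr0//; lia.
Qed.

Lemma symsum_delta (V : zmodType) (F : int -> V) k N :
  (forall j, j != k -> F j = 0) -> symsum F N = if (`|k| <= N)%N then F k else 0.
Proof.
move=> F0; elim: N => [|N IH].
  rewrite /symsum big_ord_recl big_ord0 addr0 /=.
  have [->|k0] := eqVneq k 0; first by rewrite subrr.
  rewrite F0; last by rewrite subrr eq_sym.
  by rewrite ifF//; apply/negbTE; lia.
rewrite symsumS IH; case: ifP => kN; case: ifP => kN'; try lia.
- by rewrite (F0 (- N.+1%:Z)) ?(F0 N.+1%:Z) ?add0r ?addr0//; lia.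
- have [e|e] := eqVneq k N.+1%:Z.
    by rewrite (F0 (- N.+1%:Z)) -?e ?addr0 ?add0r//; lia.
  have -> : k = - N.+1%:Z by lia.
  by rewrite (F0 N.+1%:Z) ?addr0//; lia.
- by rewrite (F0 (- N.+1%:Z)) ?(F0 N.+1%:Z) ?addr0//; lia.
Qed.

Lemma eq_symsum (V : zmodType) (F G : int -> V) N : F =1 G -> symsum F N = symsum G N.
Proof. by move=> FG; apply: eq_bigr => i _; rewrite FG. Qed.

Lemma inner_symsum (F : int -> circfun R) g N : L2 g -> (forall j, L2 (F j)) ->
  inner (symsum F N) g = symsum (fun j => inner (F j) g) N.
Proof. by move=> hg hF; rewrite inner_suml. Qed.

Lemma symsum_C (F : int -> R) N : symsum (fun j => (F j)%:C) N = (symsum F N)%:C.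
Proof. by rewrite /symsum rmorph_sum. Qed.

Lemma le_symsum (F G : int -> R) N : (forall j, F j <= G j) -> symsum F N <= symsum G N.
Proof. by move=> FG; apply: ler_sum. Qed.

Definition trig (d : int -> R[i]) N : circfun R := symsum (fun j => d j *: expi j) N.

Lemma L2_trig d N : L2 (trig d N).
Proof. by apply: L2_sum => i; apply: L2Z; exact: L2_expi. Qed.

Lemma fourier_trig d N k : fourier (trig d N) k = if (`|k| <= N)%N then d k else 0.
Proof.
rewrite /fourier inner_symsum; [|exact: L2_expi|by move=> j; apply: L2Z; exact: L2_expi].
rewrite (eq_symsum (G := fun j => d j * (j == k)%:R)) => [|j]; last first.
  by rewrite innerZl ?inner_expi//; exact: L2_expi.
rewrite (symsum_delta (k := k)) ?eqxx ?mulr1// => j /negbTE ->.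
by rewrite mulr0.
Qed.

Lemma inner_trig d f N : L2 f ->
  inner (trig d N) f = symsum (fun j => d j * (fourier f j)^*%C) N.
Proof.
move=> hf; rewrite inner_symsum//; last by move=> j; apply: L2Z; exact: L2_expi.
apply: eq_symsum => j; rewrite innerZl//; last exact: L2_expi.
by rewrite (innerC hf)//; exact: L2_expi.
Qed.

Lemma inner_trig_trig d M N : (M <= N)%N ->
  inner (trig d N) (trig d M) = (symsum (fun j => absq (d j)) M)%:C.
Proof.
move=> MN; rewrite inner_trig; last exact: L2_trig.
rewrite (symsum_trunc MN) => [|j Mj]; last first.
  by rewrite fourier_trig ifF ?rmorph0 ?mulr0//; apply/negbTE; rewrite -ltnNge.
rewrite -symsum_C; apply: eq_bigr => i _; rewrite fourier_trig ifT ?absq_mulJ//.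
by have := ltn_ord i; lia.
Qed.

Lemma nrm_trigB d M N : (M <= N)%N -> nrm (trig d N - trig d M) ^+ 2 =
  symsum (fun j => absq (d j)) N - symsum (fun j => absq (d j)) M.
Proof.
move=> MN; have hM := L2_trig d M; have hN := L2_trig d N.
rewrite nrmD_sqr ?innerNr ?nrmN//; last exact: L2N.
rewrite !sqr_nrmE !inner_trig_trig//= ; lra.
Qed.

(** Expand || S f - f ||^2 >= 0, where S f is the partial Fourier sum. *)
Lemma bessel f N : L2 f -> symsum (fun j => absq (fourier f j)) N <= nrm f ^+ 2.
Proof.
move=> hf; have hN := L2_trig (fourier f) N.
have := sqr_ge0 (nrm (trig (fourier f) N - f)).
rewrite nrmD_sqr ?innerNr ?nrmN//; last exact: L2N.
rewrite sqr_nrmE inner_trig_trig// inner_trig//.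
rewrite (eq_symsum (G := fun j => (absq (fourier f j))%:C)) => [|j]; last by rewrite absq_mulJ.
by rewrite symsum_C /=; lra.
Qed.

End FourierCoefficients.

Section Multipliers.
Context {R : realType}.
Implicit Types (f g h : circfun R) (n m j k : int).
Local Notation expi := (@expi R).
Variable c : int -> R[i].
Hypothesis c1 : forall j, absq (c j) <= 1.

(** Bounded symbols give square-summable coefficients, by the inequality of Bessel,
    so the limit chosen in the definition exists. *)
Lemma multiplierP f : L2 f -> L2 (multiplier c f) /\
  ncvg (trig (fun j => c j * fourier f j)) (multiplier c f).
Proof.
move=> hf; set d := fun j => _.
have dB N : symsum (fun j => absq (d j)) N <= nrm f ^+ 2.
  apply: le_trans (bessel N hf); apply: le_symsum => j.
  by rewrite /d absqM ler_piMl ?absq_ge0.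
have [h [hh ch]] : exists h, L2 h /\ ncvg (trig d) h.
  apply: (L2_cvg_bounded_increments _ dB); first exact: L2_trig.
  by move=> m n mn; rewrite nrm_trigB.
have := @xgetPex _ 0 [set h | L2 h /\ L2cvg (trig d) h].
move=> /(_ (ex_intro _ h (conj hh ((L2cvgE (L2_trig d) hh).2 ch)))) [h1 h2].
by split => //; apply/L2cvgE => //; exact: L2_trig.
Qed.

Lemma L2_multiplier f : L2 f -> L2 (multiplier c f).
Proof. by case/multiplierP. Qed.

Lemma fourier_multiplier f n : L2 f -> fourier (multiplier c f) n = c n * fourier f n.
Proof.
move=> hf; have [h1 h2] := multiplierP hf.
apply: (inner_lim_near (L2_trig _) h1 (L2_expi n) h2).
near=> N; rewrite -[LHS]/(fourier _ _) fourier_trig ifT//.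
by near: N; exact: nbhs_infty_ge.
Unshelve. all: by end_near. Qed.

Lemma nrm_multiplier f : L2 f -> nrm (multiplier c f) <= nrm f.
Proof.
move=> hf; have [h1 h2] := multiplierP hf.
apply: (nrm_lim_le (L2_trig _) h1 h2) => N.
rewrite -(ler_pXn2r (n := 2))// ?nnegrE ?nrm_ge0//.
apply: le_trans (bessel N hf); rewrite sqr_nrmE inner_trig_trig//.
by apply: le_symsum => j; rewrite absqM ler_piMl ?absq_ge0.
Qed.

End Multipliers.

(** * The operators on Fourier coefficients *)

(* Membership in L2 is proved by syntax-directed closure under the operations;
   the operators are opaque to it, so that no hint unfolds them into limits. *)
Create HintDb l2 discriminated.
#[export] Hint Opaque opM opR opPi opPplus opPminus opB opT opH opC expi multiplier nrm inner : l2.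
#[export] Hint Resolve L20 L2D L2Z L2N L2B L2_opR L2_opM L2_expi : l2.
Ltac l2 := solve [auto 20 with l2 nocore].

(** The coefficients of P+ f + R P- f at frequency zero, and below at a positive and
    at a negative frequency: a and b stand for the coefficients of f at n and -n, and
    v for the factor (-1)^n that R introduces. *)
Lemma fold_coef0 (F : numFieldType) (a : F) :
  1 * a + 1 * (a - 1 * a) = (1 + 0) * (2^-1 * (a + 1 * a)).
Proof. by field. Qed.

Lemma fold_coef1 (F : numFieldType) (a b v : F) :
  1 * a + v * (b - 0 * b) = (1 + 1) * (2^-1 * (a + v * b)).
Proof. by field. Qed.

Lemma fold_coefN1 (F : numFieldType) (a b v : F) :
  0 * a + v * (b - 1 * b) = (1 + (-1)) * (2^-1 * (a + v * b)).
Proof. by field. Qed.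

Section Operators.
Context {R : realType}.
Implicit Types (f g h y psi : circfun R) (n j : int) (k : R) (a : R[i]).
Local Notation expi := (@expi R).
Local Notation "f =F g" := (fourier f = fourier g) (at level 70).

(** The reflection maps e^(int) to (-1)^n e^(-int); this factor is (-1)^n. *)
Definition phase n : R[i] := (expi n pi)^*%C.

Lemma phase0 : phase 0 = 1.
Proof. by rewrite /phase expi0 conjc1. Qed.

Lemma nrm_congr f g : L2 f -> L2 g -> f =F g -> nrm f = nrm g.
Proof.
move=> hf hg /(nrm0_fourier hf hg) e; apply/eqP; rewrite eq_le.
have h1 := nrm_triangle (L2B hf hg) hg; rewrite subrK in h1.
have h2 := nrm_triangle (L2B hg hf) hf; rewrite subrK nrmBC in h2.
by rewrite e !add0r in h1 h2; rewrite h1 h2.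
Qed.

Lemma inner_congr f f' g : L2 f -> L2 f' -> L2 g -> f =F f' -> inner f g = inner f' g.
Proof.
move=> hf hf' hg /(nrm0_fourier hf hf') e; apply/eqP; rewrite -subr_eq0 -innerBl//.
by rewrite inner_nrm0//; l2.
Qed.

Definition sgnc n : R[i] := (sgz n)%:~R.

Lemma absq_symbolH n : absq (- 'i%C * (sgz n)%:~R : R[i]) <= 1.
Proof.
rewrite absqM; case: sgzP => _; rewrite /absq /= ?expr0n ?expr1n ?oppr0 ?addr0 ?mulr0 ?sqrrN ?expr0n ?expr1n ?add0r ?mul1r //=; lra.
Qed.

Lemma L2_opH f : L2 f -> L2 (opH f).
Proof. exact: (L2_multiplier absq_symbolH). Qed.

Lemma fourier_opH f n : L2 f -> fourier (opH f) n = - 'i%C * sgnc n * fourier f n.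
Proof. exact: (fourier_multiplier absq_symbolH). Qed.

Lemma nrm_opH f : L2 f -> nrm (opH f) <= nrm f.
Proof. exact: (nrm_multiplier absq_symbolH). Qed.

Lemma absq_symbolP n : absq (if 0 <= n then 1 else 0 : R[i]) <= 1.
Proof. by case: ifP => _; rewrite /absq /= ?expr0n ?expr1n addr0. Qed.

Lemma L2_opPplus f : L2 f -> L2 (opPplus f).
Proof. exact: (L2_multiplier absq_symbolP). Qed.

Lemma fourier_opPplus f n : L2 f -> fourier (opPplus f) n = (if 0 <= n then 1 else 0) * fourier f n.
Proof. exact: (fourier_multiplier absq_symbolP). Qed.

Hint Resolve L2_opH L2_opPplus : l2.

Lemma L2_opPi f : L2 f -> L2 (opPi f).
Proof. by move=> hf; rewrite /opPi; l2. Qed.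

Lemma L2_opB f : L2 f -> L2 (opB f).
Proof. by move=> hf; rewrite /opB /opPminus; l2. Qed.

Hint Resolve L2_opPi L2_opB : l2.

Lemma opPi_fixed f : opR (opPi f) = opPi f.
Proof. by rewrite /opPi opRZ opRD opRK addrC. Qed.

Lemma opPiE f : opPi f = 2^-1 *: (f + opR f). Proof. by []. Qed.
Lemma opBE f : opB f = opPplus f + opR (f - opPplus f). Proof. by []. Qed.
(* Conversion must not compare the operators through the limits that define
   them. *)
Opaque fourier inner nrm opR opM opPi opPplus opPminus opB opT opH opC.

Lemma fourier_opPi f n : L2 f ->
  fourier (opPi f) n = 2^-1 * (fourier f n + phase n * fourier f (- n)).
Proof. move=> hf; have hR := L2_opR hf.
by rewrite opPiE (fourierZ _ _ (L2D hf hR)) (fourierD _ hf hR) (fourier_opR n hf). Qed.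

(** The identity B = (I + iH) P: at a positive frequency P+ f contributes the
    coefficient of f and R P- f that of R f; at a negative frequency both vanish. *)
Lemma fourier_opB f n : L2 f -> fourier (opB f) n = (1 + sgnc n) * fourier (opPi f) n.
Proof.
move=> hf; rewrite opBE fourierD; [|l2..].
rewrite fourier_opR; [|l2]; rewrite fourierB; [|l2..].
rewrite !(fourier_opPplus _ hf) (fourier_opPi _ hf) -/(phase n) oppr_ge0 /sgnc.
case: sgzP => [->|n0|n0].
- by rewrite oppr0 phase0 mulr0z; exact: fold_coef0.
- by rewrite mulr1z; exact: fold_coef1.
- by rewrite mulrN1z; exact: fold_coefN1.
Qed.

Lemma sgncD1_neq0 n : 0 <= n -> 1 + sgnc n != 0.
Proof.
move=> n0; rewrite /sgnc -[1]/(1%:~R) -intrD intr_eq0.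
by case: sgzP n0.
Qed.

End Operators.

Section AntisymmetricMultiplier.
Context {R : realType}.
Implicit Types (f g F G : circfun R).

Lemma complex_eq_oppJ (z z' : R[i]) :
  complex.Re z = - complex.Re z' -> complex.Im z = complex.Im z' -> z = - z'^*%C.
Proof. by case: z z' => a b [c d] /= -> ->; simpc. Qed.

(** A multiplier with purely imaginary symbol is skew-adjoint: this holds for the
    partial sums, and passes to the limit. *)
Lemma inner_antisym_limits (c : int -> R[i]) f g F G :
  (forall j, (c j)^*%C = - c j) -> L2 f -> L2 g -> L2 F -> L2 G ->
  ncvg (trig (fun j => c j * fourier f j)) F ->
  ncvg (trig (fun j => c j * fourier g j)) G ->
  inner F g = - inner f G.
Proof.
move=> cJ hf hg hF hG cF cG.
have [rF iF] := inner_cvg (L2_trig _) hF hg cF.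
have [rG iG] := inner_cvg (L2_trig _) hG hf cG.
have cM (a b : R[i]) : (a * b)^*%C = a^*%C * b^*%C by exact: rmorphM.
have e N : inner (trig (fun j => c j * fourier f j) N) g =
    - (inner (trig (fun j => c j * fourier g j) N) f)^*%C.
  rewrite (inner_trig _ _ hg) (inner_trig _ _ hf) /symsum rmorph_sum -sumrN.
  apply: eq_bigr => m _; move: (m%:Z - N%:Z) => j.
  transitivity (- (c j * fourier g j * (fourier f j)^*%C)^*%C); last by [].
  rewrite !cM conjcK cJ !mulNr opprK -!mulrA; congr (_ * _).
  exact: mulrC.
rewrite (innerC hG hf).
have hr : complex.Re (inner F g) = - complex.Re (inner G f).
  rewrite -(cvg_lim _ rF)//; apply: cvg_lim => //.
  rewrite (_ : (fun N => _) = (fun N =>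
    - complex.Re (inner (trig (fun j => c j * fourier g j) N) f))); last first.
    by apply/funext => N; rewrite e; case: (inner _ f).
  exact: cvgN.
have hi : complex.Im (inner F g) = complex.Im (inner G f).
  rewrite -(cvg_lim _ iF)//; apply: cvg_lim => //.
  rewrite (_ : (fun N => _) = (fun N =>
    complex.Im (inner (trig (fun j => c j * fourier g j) N) f)))//.
  by apply/funext => N; rewrite e; case: (inner _ f) => a b /=; rewrite opprK.
exact: complex_eq_oppJ.
Qed.

Lemma inner_opH f g : L2 f -> L2 g -> inner (opH f) g = - inner f (opH g).
Proof.
move=> hf hg.
have [hF cF] := multiplierP (@absq_symbolH R) hf.
have [hG cG] := multiplierP (@absq_symbolH R) hg.
apply: (inner_antisym_limits _ hf hg hF hG cF cG) => j.
move: (sgz j) => m.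
have -> : (m%:~R : R[i]) = (m%:~R : R)%:C by rewrite rmorph_int.
by simpc.
Qed.

End AntisymmetricMultiplier.

(** * Neumann series *)

Section Neumann.
Context {R : realType}.
Implicit Types (f g h : circfun R).
Local Notation "f =F g" := (fourier f = fourier g) (at level 70).

(** Operators defined by a limit in L^2 are additive only up to a.e. equality, which
    is expressed here on Fourier coefficients. *)
Record L2contraction (A : circfun R -> circfun R) (q : R) : Prop := L2Contraction {
  contraction_L2 : forall f, L2 f -> L2 (A f);
  contraction_sub : forall f g, L2 f -> L2 g -> A (f - g) =F (A f - A g);
  contraction_congr : forall f g, L2 f -> L2 g -> f =F g -> A f =F A g;
  contraction_nrm : forall f, L2 f -> nrm (A f) <= q * nrm f;
  contraction_ge0 : 0 <= q;
  contraction_lt1 : q < 1 }.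

Lemma nrm_sub_congr f f' g g' : L2 f -> L2 f' -> L2 g -> L2 g' ->
  f =F f' -> g =F g' -> nrm (f - g) = nrm (f' - g').
Proof.
move=> hf hf' hg hg' e e'; apply: nrm_congr; [l2..|].
by apply/funext => n; rewrite (fourierB n hf hg) (fourierB n hf' hg') e e'.
Qed.

Lemma nrm_eq0_fourier f g : L2 f -> L2 g -> nrm (f - g) = 0 -> f =F g.
Proof. by move=> hf hg /(nrm0_fourier hf hg). Qed.

Lemma contraction_nrmB A q f g : L2contraction A q -> L2 f -> L2 g ->
  nrm (A f - A g) <= q * nrm (f - g).
Proof.
move=> cA hf hg; have hAf := contraction_L2 cA hf; have hAg := contraction_L2 cA hg.
have hd := L2B hf hg.
rewrite -(nrm_congr (contraction_L2 cA hd) (L2B hAf hAg) (contraction_sub cA hf hg)).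
exact: contraction_nrm.
Qed.

Lemma contraction_unique A q u0 s s' : L2contraction A q -> L2 u0 -> L2 s -> L2 s' ->
  s =F (u0 + A s) -> s' =F (u0 + A s') -> s =F s'.
Proof.
move=> cA h0 hs hs' e e'; apply: nrm_eq0_fourier => //.
have hA := contraction_L2 cA hs; have hA' := contraction_L2 cA hs'.
have := contraction_nrmB cA hs hs'.
have -> : nrm (A s - A s') = nrm (s - s').
  rewrite (nrm_sub_congr hs (L2D h0 hA) hs' (L2D h0 hA') e e').
  by congr nrm; rewrite opprD addrACA subrr add0r.
have q1 := contraction_lt1 cA; have n0 := nrm_ge0 (s - s').
move: (nrm (s - s')) n0 => x x0 xq; apply/eqP; rewrite eq_le x0 andbT.
by rewrite leNgt; apply/negP => x1; move: xq; rewrite leNgt gtr_pMl// q1.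
Qed.

Lemma seriesS (u : nat -> circfun R) n : series u n.+1 = series u n + u n.
Proof. by rewrite /series /= big_nat_recr. Qed.

(** The terms decay geometrically, so the series converges; its partial sums satisfy
    S (n+1) = u 0 + A (S n), and A is continuous. *)
Lemma neumann A q (u : nat -> circfun R) : L2contraction A q ->
  (forall n, L2 (u n)) -> (forall n, u n.+1 =F A (u n)) ->
  exists s, [/\ L2 s, ncvg (series u) s & s =F (u 0%N + A s)].
Proof.
move=> cA hu uA.
have q0 := contraction_ge0 cA; have q1 := contraction_lt1 cA.
have hS n : L2 (series u n) by apply: L2_sum.
have un n : nrm (u n) <= q ^+ n * nrm (u 0%N).
  elim: n => [|n IH]; first by rewrite mul1r.
  rewrite (nrm_congr (hu _) (contraction_L2 cA (hu n)) (uA n)).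
  by rewrite exprS -mulrA (le_trans (contraction_nrm cA (hu n)))// ler_wpM2l.
pose N0 := nrm (u 0%N); have N00 : 0 <= N0 := nrm_ge0 _.
(* partial sums of the geometric series that dominates the terms *)
pose A' n := N0 * (1 - q ^+ n) / (1 - q).
have p : 0 < 1 - q by rewrite subr_gt0.
have A'S n : A' n.+1 = A' n + q ^+ n * N0.
  by rewrite /A' exprS; field; rewrite gt_eqF.
have SA m n : (m <= n)%N -> nrm (series u n - series u m) <= A' n - A' m.
  move=> mn; rewrite -(subnK mn); elim: (n - m)%N => [|i IH].
    rewrite add0n !subrr; have -> // : nrm (0 : circfun R) = 0.
    by have := nrmZ 0 (@L20 R); rewrite scale0r Normc.normc0 mul0r.
  rewrite addSn seriesS A'S [X in X - _]addrC -addrA [leRHS](_ : _ = q ^+ (i + m) * N0 + (A' (i + m)%N - A' m)); last by ring.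
  by apply: le_trans (nrm_triangle (hu _) (L2B (hS _) (hS _))) _; rewrite lerD.
have A'B n : 0 <= A' n <= N0 / (1 - q).
  have qn : 0 <= q ^+ n <= 1 by rewrite exprn_ge0//= exprn_ile1// ltW.
  case/andP: qn => qn0 qn1; apply/andP; split.
    by rewrite divr_ge0 ?mulr_ge0 ?subr_ge0// ltW.
  by rewrite ler_pM2r ?invr_gt0// ler_piMr// gerBl.
pose K := N0 / (1 - q).
have K0 : 0 <= K by rewrite divr_ge0// ltW.
have [s [hs cs]] : exists h, L2 h /\ ncvg (series u) h.
  (* squared increments are at most K times the increments, K being their bound *)
  apply: (@L2_cvg_bounded_increments _ _ (fun n => K * A' n) (K * K)) => // [n|m n mn].
    by case/andP: (A'B n) => _; exact: ler_wpM2l.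
  have d1 := SA m n mn; have d0 := nrm_ge0 (series u n - series u m).
  case/andP: (A'B n) => n1 n2; case/andP: (A'B m) => m1 m2.
  rewrite expr2 -mulrBr ler_pM//; apply: (le_trans d1).
  by rewrite -/K in n2 *; lra.
exists s; split => //; have hA := contraction_L2 cA hs.
have SS n : series u n.+1 =F (u 0%N + A (series u n)).
  elim: n => [|n IH].
    rewrite seriesS /series /= big_geq// add0r.
    have hz := @L20 R; have hAz := contraction_L2 cA hz.
    have z : A 0 =F 0.
      apply: nrm_eq0_fourier => //; rewrite subr0; apply/eqP.
      rewrite eq_le nrm_ge0 andbT (le_trans (contraction_nrm cA hz))//.
      have -> : nrm (0 : circfun R) = 0.
        by have := nrmZ 0 hz; rewrite scale0r Normc.normc0 mul0r.
      by rewrite mulr0.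
    apply/funext => m; rewrite (fourierD m (hu 0%N) hAz) z.
    by rewrite -(fourierD m (hu 0%N) hz) addr0.
  have hAS := contraction_L2 cA (hS n); have hAS' := contraction_L2 cA (hS n.+1).
  have hAu := contraction_L2 cA (hu n).
  apply/funext => m.
  rewrite seriesS (fourierD m (hS _) (hu _)) IH uA.
  rewrite (fourierD m (hu 0%N) hAS) (fourierD m (hu 0%N) hAS') -addrA; congr (_ + _).
  have e : (A (series u n.+1) - A (series u n)) =F A (u n).
    rewrite -(contraction_sub cA (hS _) (hS _)) seriesS.
    by rewrite addrAC subrr add0r.
  by rewrite -e (fourierB m hAS' hAS) addrC subrK.
apply: nrm_eq0_fourier; [l2..|].
apply: (@ncvg_unique _ (fun n => series u n.+1)) => //; first by l2.
- apply/ncvgP => e e0; have [N hN] := (ncvgP _ _).1 cs e e0; exists N => n Nn.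
  by apply: hN; exact: leqW.
- apply/ncvgP => e e0; have [N hN] := (ncvgP _ _).1 cs e e0; exists N => n Nn.
  have hAS := contraction_L2 cA (hS n).
  rewrite (nrm_sub_congr (hS _) (L2D (hu 0%N) hAS) (L2D (hu 0%N) hA) (L2D (hu 0%N) hA) (SS n) erefl).
  rewrite [X in nrm X](_ : _ = A (series u n) - A s); last first.
    by rewrite opprD addrACA subrr add0r.
  apply: le_trans (contraction_nrmB cA (hS n) hs) _.
  apply: le_trans (hN n Nn); rewrite ler_piMl ?nrm_ge0//; exact: ltW.
Qed.

End Neumann.

(** * The boundary equation *)

#[export] Hint Resolve L2_opPi : l2.

Lemma half_sum (F : numFieldType) (a : F) : 2^-1 * (a + a) = a.
Proof. by field. Qed.

Lemma reflect_coef (F : comPzRingType) (i s a x : F) :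
  a * (i * - s * x) = - (i * s * (a * x)).
Proof. ring. Qed.

Lemma square_coef (F : comPzRingType) (i s x : F) :
  - i * s * (- i * s * x) = i * i * (s * s) * x.
Proof. ring. Qed.

Lemma unfold_coef0 (F : numFieldType) (a : F) : a = (1 + 0) * (2^-1 * (a + 1 * a)).
Proof. by field. Qed.

Lemma unfold_coef1 (F : numFieldType) (a : F) : a = (1 + 1) * (2^-1 * (a + 0)).
Proof. by field. Qed.

Lemma eq_opp0 (F : numFieldType) (a : F) : a = - a -> a = 0.
Proof. by move/eqP; rewrite -addr_eq0 -mulr2n mulrn_eq0 /= => /eqP. Qed.

(** The argument uses the operators H and B only through the properties assumed in
    this section, mostly their action on Fourier coefficients, and H and B are kept
    abstract so that conversion never reaches the limits that define them. *)
Section OperatorAlgebra.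
Context {R : realType}.
Implicit Types (f g h y psi : circfun R) (n j : int) (k : R) (a : R[i]).
Local Notation expi := (@expi R).
Local Notation "f =F g" := (fourier f = fourier g) (at level 70).

Variables H B : circfun R -> circfun R.
Hypothesis L2_H : forall f, L2 f -> L2 (H f).
Hypothesis fourier_H : forall f n, L2 f -> fourier (H f) n = - 'i%C * sgnc n * fourier f n.
Hypothesis nrm_H : forall f, L2 f -> nrm (H f) <= nrm f.
Hypothesis inner_H : forall f g, L2 f -> L2 g -> inner (H f) g = - inner f (H g).
Hypothesis L2_B : forall f, L2 f -> L2 (B f).
Hypothesis fourier_B : forall f n, L2 f -> fourier (B f) n = (1 + sgnc n) * fourier (opPi f) n.
Hint Resolve L2_H L2_B : l2.

Lemma L2plusP y : L2plus y <-> L2 y /\ opR y =F y.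
Proof.
split => [[hy /ae_fourier e]|[hy e]]; split => //; first by apply: e; l2.
by apply/ae_fourier => //; l2.
Qed.

Lemma L2plus_L2 y : L2plus y -> L2 y. Proof. by case. Qed.
Lemma L2plus_R y : L2plus y -> opR y =F y. Proof. by move/L2plusP => []. Qed.

Lemma H_congr f g : L2 f -> L2 g -> f =F g -> H f =F H g.
Proof. by move=> hf hg e; apply/funext => n; rewrite (fourier_H n hf) (fourier_H n hg) e. Qed.

Lemma opR_congr f g : L2 f -> L2 g -> f =F g -> opR f =F opR g.
Proof. by move=> hf hg e; apply/funext => n; rewrite (fourier_opR n hf) (fourier_opR n hg) e. Qed.

Lemma opPi_congr f g : L2 f -> L2 g -> f =F g -> opPi f =F opPi g.
Proof. by move=> hf hg e; apply/funext => n; rewrite (fourier_opPi n hf) (fourier_opPi n hg) e. Qed.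

Lemma B_congr f g : L2 f -> L2 g -> f =F g -> B f =F B g.
Proof. move=> hf hg e; have e' := opPi_congr hf hg e.
by apply/funext => n; rewrite (fourier_B n hf) (fourier_B n hg) e'. Qed.

Lemma add_congr f f' g g' : L2 f -> L2 f' -> L2 g -> L2 g' ->
  f =F f' -> g =F g' -> (f + g) =F (f' + g').
Proof.
move=> hf hf' hg hg' e e'; apply/funext => n.
by rewrite (fourierD n hf hg) (fourierD n hf' hg') e e'.
Qed.

Lemma scale_congr a f f' : L2 f -> L2 f' -> f =F f' -> (a *: f) =F (a *: f').
Proof. by move=> hf hf' e; apply/funext => n; rewrite (fourierZ a n hf) (fourierZ a n hf') e. Qed.

Lemma opp_congr f f' : L2 f -> L2 f' -> f =F f' -> (- f) =F (- f').
Proof. by move=> hf hf' e; apply/funext => n; rewrite (fourierN n hf) (fourierN n hf') e. Qed.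

Lemma H_add f g : L2 f -> L2 g -> H (f + g) =F (H f + H g).
Proof.
move=> hf hg; apply/funext => n.
rewrite (fourier_H n (L2D hf hg)) (fourierD n hf hg) mulrDr.
by rewrite (fourierD n (L2_H hf) (L2_H hg)) (fourier_H n hf) (fourier_H n hg).
Qed.

Lemma H_scale a f : L2 f -> H (a *: f) =F (a *: H f).
Proof.
move=> hf; apply/funext => n.
rewrite (fourier_H n (L2Z a hf)) (fourierZ a n hf) mulrCA.
by rewrite (fourierZ a n (L2_H hf)) (fourier_H n hf).
Qed.

Lemma H_opp f : L2 f -> H (- f) =F (- H f).
Proof. by move=> hf; rewrite -(scaleN1r f) -(scaleN1r (H f)); exact: H_scale. Qed.

Lemma H_sub f g : L2 f -> L2 g -> H (f - g) =F (H f - H g).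
Proof.
move=> hf hg; rewrite (H_add hf (L2N hg)).
by apply: add_congr; [l2..| |exact: H_opp].
Qed.

Lemma L2plusD f g : L2plus f -> L2plus g -> L2plus (f + g).
Proof.
move=> /L2plusP[hf ef] /L2plusP[hg eg]; apply/L2plusP; split; first by l2.
by rewrite opRD; apply: add_congr => //; l2.
Qed.

Lemma L2plusZ a f : L2plus f -> L2plus (a *: f).
Proof.
move=> /L2plusP[hf ef]; apply/L2plusP; split; first by l2.
by rewrite opRZ; apply: scale_congr => //; l2.
Qed.

Lemma L2plusN f : L2plus f -> L2plus (- f).
Proof. by rewrite -scaleN1r; exact: L2plusZ. Qed.

Lemma L2plusB f g : L2plus f -> L2plus g -> L2plus (f - g).
Proof. by move=> hf hg; apply: L2plusD => //; exact: L2plusN. Qed.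

Lemma L2plus_opPi f : L2 f -> L2plus (opPi f).
Proof. by move=> hf; apply/L2plusP; split; [l2|rewrite opPi_fixed]. Qed.

Lemma opPi_id y : L2plus y -> opPi y =F y.
Proof.
move=> /L2plusP[hy e]; apply/funext => n; rewrite (fourier_opPi n hy).
have -> : phase n * fourier y (- n) = fourier y n.
  by rewrite -[in RHS]e (fourier_opR n hy).
exact: half_sum.
Qed.

(** The symbol of H is odd, and R exchanges the frequencies n and -n. *)
Lemma opR_H f : L2 f -> opR (H f) =F (- H (opR f)).
Proof.
move=> hf; have hR := L2_opR hf; have hH := L2_H hf; apply/funext => n.
rewrite (fourier_opR n hH) (fourier_H (- n) hf) (fourierN n (L2_H hR)).
rewrite (fourier_H n hR) (fourier_opR n hf) /sgnc sgzN rmorphN.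
exact: reflect_coef.
Qed.

Lemma opR_H_plus y : L2plus y -> opR (H y) =F (- H y).
Proof.
move=> /L2plusP[hy e]; rewrite (opR_H hy).
by apply: opp_congr; [l2..|]; apply: H_congr => //; l2.
Qed.

(** R anticommutes with both M and H, so it commutes with MH and with HM. *)
Lemma L2plus_MH y : L2plus y -> L2plus (opM (H y)).
Proof.
move=> hp; have hy := L2plus_L2 hp; apply/L2plusP; split; first by l2.
rewrite opR_opM -opMN; apply: opM_congr; [l2..|].
rewrite -[in RHS](opprK (H y)); apply: opp_congr; [l2..|].
exact: opR_H_plus.
Qed.

Lemma opR_opM_plus y : L2plus y -> opR (opM y) =F (- opM y).
Proof.
move=> /L2plusP[hy e]; rewrite opR_opM.
by apply: opp_congr; [l2..|]; apply: opM_congr => //; l2.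
Qed.

Lemma L2plus_HM y : L2plus y -> L2plus (H (opM y)).
Proof.
move=> hp; have hy := L2plus_L2 hp; apply/L2plusP; split; first by l2.
have hM : L2 (opM y) by l2.
rewrite (opR_H hM) -[in RHS](opprK (H _)); apply: opp_congr; [l2..|].
rewrite -(H_opp hM); apply: H_congr; [l2..|].
exact: opR_opM_plus.
Qed.

(** R preserves means, while R M y = - M y. *)
Lemma mean_opM y : L2plus y -> fourier (opM y) 0 = 0.
Proof.
move=> hp; have hM := L2_opM (L2plus_L2 hp); apply: eq_opp0.
have := congr1 (fun F => F 0) (opR_opM_plus hp).
by rewrite (fourier_opR 0 hM) (fourierN 0 hM) oppr0 -/(phase 0) phase0 mul1r.
Qed.

Lemma mean_H f : L2 f -> fourier (H f) 0 = 0.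
Proof. by move=> hf; rewrite (fourier_H 0 hf) /sgnc sgz0 mulr0z mulr0 mul0r. Qed.

Lemma HK f : L2 f -> fourier f 0 = 0 -> H (H f) =F (- f).
Proof.
move=> hf f0; apply/funext => n.
rewrite (fourier_H n (L2_H hf)) (fourier_H n hf) (fourierN n hf).
have [->|n0] := eqVneq n 0; first by rewrite f0 oppr0 !mulr0.
have s2 : sgnc n * sgnc n = 1 :> R[i] by rewrite /sgnc -intrM; case: sgzP n0.
have i2 : 'i%C * 'i%C = -1 :> R[i] by rewrite -expr2 sqr_i.
by rewrite square_coef i2 s2 mulr1 mulN1r.
Qed.

(** C inverts - HM on the left: HM is injective and C is onto. *)
Lemma MHHM y : L2plus y -> opM (H (H (opM y))) =F (- y).
Proof.
move=> hp; have hy := L2plus_L2 hp; have hM := L2_opM hy.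
rewrite (opM_congr _ _ (HK hM (mean_opM hp))); [|l2..].
rewrite opMN; apply: opp_congr; [l2..|].
by apply/nrm0_fourier; [l2..|exact: opMK].
Qed.

(** ** Reduction to the functions fixed by R *)

(** Twice the Riesz projection of y, up to the mean: the symbol is 1 + sgn n. *)
Definition cauchy y := y + 'i%C *: H y.

Lemma L2_cauchy y : L2 y -> L2 (cauchy y).
Proof. by move=> hy; rewrite /cauchy; l2. Qed.
Hint Resolve L2_cauchy : l2.

Lemma fourier_cauchy y n : L2 y -> fourier (cauchy y) n = (1 + sgnc n) * fourier y n.
Proof.
move=> hy; have hH := L2_H hy.
rewrite (fourierD n hy (L2Z _ hH)) (fourierZ _ n hH) (fourier_H n hy).
have i2 : 'i%C * 'i%C = -1 :> R[i] by rewrite -expr2 sqr_i.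
rewrite !mulrA mulrN i2 opprK mul1r mulrDl mul1r //.
Qed.

Lemma cauchy_congr y y' : L2 y -> L2 y' -> y =F y' -> cauchy y =F cauchy y'.
Proof.
by move=> hy hy' e; apply/funext => n; rewrite (fourier_cauchy n hy) (fourier_cauchy n hy') e.
Qed.

(** The coefficients at n >= 0 are recovered from those of y + iHy, and the others by
    the symmetry of y. *)
Lemma cauchy_inj y y' : L2plus y -> L2plus y' -> cauchy y =F cauchy y' -> y =F y'.
Proof.
move=> /L2plusP[hy ey] /L2plusP[hy' ey'] e; apply/funext => n.
have pos m : 0 <= m -> fourier y m = fourier y' m.
  move=> m0; have := congr1 (fun F => F m) e.
  rewrite (fourier_cauchy m hy) (fourier_cauchy m hy').
  exact: mulfI (sgncD1_neq0 m0) _ _.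
have [n0|n0] := leP 0 n; first exact: pos.
have nn : 0 <= - n by rewrite oppr_ge0 ltW.
rewrite -[in LHS]ey -[in RHS]ey' (fourier_opR n hy) (fourier_opR n hy').
by rewrite (pos _ nn).
Qed.

Lemma B_cauchy y : L2plus y -> B y =F cauchy y.
Proof.
move=> hp; have hy := L2plus_L2 hp; apply/funext => n.
by rewrite (fourier_B n hy) (fourier_cauchy n hy) (opPi_id hp).
Qed.

(** B = (I + iH) P, and I + iH is injective on L^2_+. *)
Lemma B_inj f g : L2 f -> L2 g -> B f =F B g -> opPi f =F opPi g.
Proof.
move=> hf hg e; apply: cauchy_inj; [exact: L2plus_opPi..|].
apply/funext => n; rewrite (fourier_cauchy n (L2_opPi hf)) (fourier_cauchy n (L2_opPi hg)).
by rewrite -(fourier_B n hf) -(fourier_B n hg) e.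
Qed.

Lemma B_add f g : L2 f -> L2 g -> B (f + g) =F (B f + B g).
Proof.
move=> hf hg; apply/funext => n.
rewrite (fourier_B n (L2D hf hg)) (fourierD n (L2_B hf) (L2_B hg)).
rewrite (fourier_B n hf) (fourier_B n hg) -mulrDr -(fourierD n (L2_opPi hf) (L2_opPi hg)).
congr (_ * fourier _ n); rewrite /opPi opRD -scalerDr; congr (_ *: _).
by rewrite addrACA.
Qed.

Lemma B_scale a f : L2 f -> B (a *: f) =F (a *: B f).
Proof.
move=> hf; apply/funext => n.
rewrite (fourier_B n (L2Z a hf)) (fourierZ a n (L2_B hf)) (fourier_B n hf).
rewrite mulrCA -(fourierZ a n (L2_opPi hf)); congr (_ * fourier _ n).
by rewrite /opPi opRZ -scalerDr !scalerA mulrC.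
Qed.

Definition MH y := opM (H y).

Lemma L2_MH y : L2 y -> L2 (MH y).
Proof. by move=> hy; rewrite /MH; l2. Qed.
Hint Resolve L2_MH : l2.

Lemma two_i_neq0 : 2 * 'i%C != 0 :> R[i].
Proof. by rewrite mulf_neq0 ?pnatr_eq0// eq_complex /= oner_eq0 andbF. Qed.

Lemma cauchyB_R y : L2plus y -> (cauchy y - opR (cauchy y)) =F ((2 * 'i%C) *: H y).
Proof.
move=> hp; have hy := L2plus_L2 hp; have hH := L2_H hy; have hR := L2_opR hy.
have hc := L2_cauchy hy; have hRH := L2_opR hH.
apply/funext => n; rewrite (fourierB n hc (L2_opR hc)) (fourierZ _ n hH).
rewrite /cauchy opRD opRZ (fourierD n hy (L2Z _ hH)) (fourierD n hR (L2Z _ hRH)).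
rewrite (fourierZ _ n hH) (fourierZ _ n hRH) (L2plus_R hp) (opR_H_plus hp) (fourierN n hH).
by rewrite mulrN opprD opprK addrACA subrr add0r -mulrDl -mulr2n -(mulr_natl 'i%C).
Qed.

Variable k : R.

(** Since (I - R) psi = 2i Hy, the left-hand side is B applied to
    2i (y + kCy), and B is injective on L^2_+. *)
Lemma boundary_cauchy g y psi : L2 g -> L2plus y -> L2 psi -> psi =F cauchy y ->
  ((2 * 'i%C) *: psi + k%:C *: B (opM (psi - opR psi))) =F B g <->
  ((2 * 'i%C) *: (y + k%:C *: MH y)) =F opPi g.
Proof.
move=> hg hp hpsi epsi; have hy := L2plus_L2 hp; have hH := L2_H hy.
have hpm : L2plus ((2 * 'i%C) *: (y + k%:C *: MH y)).
  by apply: L2plusZ; apply: L2plusD => //; apply: L2plusZ; exact: L2plus_MH.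
have hd : L2 (psi - opR psi) by l2.
have ed : (psi - opR psi) =F ((2 * 'i%C) *: H y).
  rewrite -(cauchyB_R hp); apply: add_congr; [l2..|exact: epsi|].
  by apply: opp_congr; [l2..|]; apply: opR_congr => //; l2.
have eT : B (opM (psi - opR psi)) =F ((2 * 'i%C) *: B (MH y)).
  rewrite -(B_scale _ (L2_MH hy)) -opMZ.
  by apply: B_congr; [l2..|]; apply: opM_congr; [l2..|].
have -> : fourier ((2 * 'i%C) *: psi + k%:C *: B (opM (psi - opR psi))) =
    fourier (B ((2 * 'i%C) *: (y + k%:C *: MH y))).
  have hk : L2 (k%:C *: MH y) by l2.
  have hyk : L2 (y + k%:C *: MH y) by l2.
  rewrite (B_scale _ hyk).
  transitivity (fourier ((2 * 'i%C) *: (B y + k%:C *: B (MH y)))).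
    rewrite scalerDr; apply: add_congr; [l2..| |].
      by apply: scale_congr; [l2..|rewrite epsi (B_cauchy hp)].
    rewrite scalerA mulrC -scalerA; apply: scale_congr; [l2..|exact: eT].
  apply: scale_congr; [l2..|].
  rewrite (B_add hy hk); apply: add_congr; [l2..|by []|].
  by rewrite (B_scale _ (L2_MH hy)).
split => [e|e].
  by rewrite -(B_inj (L2plus_L2 hpm) hg e) (opPi_id hpm).
apply/funext => n; rewrite (fourier_B n (L2plus_L2 hpm)) (fourier_B n hg).
by rewrite (opPi_id hpm) e.
Qed.

(** At a negative frequency both terms in the range of B vanish, hence so does the
    coefficient of psi; a function without negative frequencies is (I + iH) P of
    itself. *)
Lemma boundary_form g psi : L2 g -> L2 psi ->
  ((2 * 'i%C) *: psi + k%:C *: B (opM (psi - opR psi))) =F B g ->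
  psi =F cauchy (opPi psi).
Proof.
move=> hg hpsi e; have hPi := L2_opPi hpsi.
have hM : L2 (opM (psi - opR psi)) by l2.
have hT := L2_B hM.
have neg m : m < 0 -> fourier psi m = 0.
  move=> m0; have s0 : 1 + sgnc m = 0 :> R[i] by rewrite /sgnc ltr0_sgz// mulrN1z subrr.
  have := congr1 (fun F => F m) e; rewrite (fourierD m (L2Z _ hpsi) (L2Z _ hT)).
  rewrite (fourierZ _ m hpsi) (fourierZ _ m hT) (fourier_B m hM) (fourier_B m hg).
  rewrite s0 !mul0r mulr0 addr0 => /eqP; rewrite mulf_eq0 (negbTE two_i_neq0) /=.
  by move/eqP.
apply/funext => n; rewrite (fourier_cauchy n hPi) (fourier_opPi n hpsi) /sgnc.
case: sgzP => [->|n0|n0].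
- by rewrite phase0 mulr0z oppr0; exact: unfold_coef0.
- by rewrite (neg (- n)) ?oppr_lt0// mulr0 mulr1z; exact: unfold_coef1.
- by rewrite neg// mulrN1z subrr mul0r.
Qed.

(** ** The operator I + kC *)

Lemma contraction_scaled (c : R) (A : circfun R -> circfun R) :
  (forall f, L2 f -> L2 (A f)) ->
  (forall f g, L2 f -> L2 g -> A (f - g) =F (A f - A g)) ->
  (forall f g, L2 f -> L2 g -> f =F g -> A f =F A g) ->
  (forall f, L2 f -> nrm (A f) <= nrm f) ->
  `|c| < 1 -> L2contraction (fun f => c%:C *: A f) `|c|.
Proof.
move=> LA subA congrA nrmA c1; split => //.
- by move=> f hf; apply: L2Z; exact: LA.
- move=> f g hf hg; rewrite -scalerBr; apply: scale_congr; last exact: subA.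
    by apply: LA; l2.
  by apply: L2B; exact: LA.
- by move=> f g hf hg e; apply: scale_congr; [exact: LA..|exact: congrA].
- move=> f hf; rewrite (nrmZ _ (LA _ hf)) normcR.
  by apply: ler_wpM2l => //; exact: nrmA.
Qed.

Lemma contraction_MH (c : R) : `|c| < 1 -> L2contraction (fun f => c%:C *: opM (H f)) `|c|.
Proof.
apply: contraction_scaled => [f hf|f g hf hg|f g hf hg e|f hf]; first by l2.
- rewrite -opMB; apply: opM_congr; [l2..|exact: H_sub].
- by apply: opM_congr; [l2..|exact: H_congr].
- by rewrite (nrm_opM (L2_H hf)); exact: nrm_H.
Qed.

Lemma contraction_HM (c : R) : `|c| < 1 -> L2contraction (fun f => c%:C *: H (opM f)) `|c|.
Proof.
apply: contraction_scaled => [f hf|f g hf hg|f g hf hg e|f hf]; first by l2.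
- by rewrite opMB; apply: H_sub; l2.
- by apply: H_congr; [l2..|exact: opM_congr].
- by rewrite -[leRHS](nrm_opM hf); apply: nrm_H; l2.
Qed.

(** The form in which the contraction results apply. *)
Lemma neg_fixpoint (h s : circfun R) : L2 h -> L2 s ->
  (s + k%:C *: MH s) =F h <-> s =F (h + (- k)%:C *: MH s).
Proof.
move=> hh hs; have hM := L2_MH hs.
have kN : ((- k)%:C : R[i]) = - k%:C by rewrite rmorphN.
split=> e; apply/funext => n.
  by rewrite kN scaleNr (fourierB n hh (L2Z _ hM)) -e (fourierD n hs (L2Z _ hM)) addrK.
rewrite (fourierD n hs (L2Z _ hM)) [fourier s]e kN scaleNr.
by rewrite (fourierB n hh (L2Z _ hM)) subrK.
Qed.

(** The reflection of a fixed point is a fixed point, hence the same one. *)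
Lemma L2plus_fixpoint A q u0 s : L2contraction A q -> L2plus u0 -> L2 s ->
  (forall f, L2 f -> opR (A f) =F A (opR f)) -> s =F (u0 + A s) -> L2plus s.
Proof.
move=> cA h0 hs RA e; apply/L2plusP; split => //.
have hu := L2plus_L2 h0; have hA := contraction_L2 cA hs; have hR := L2_opR hs.
have hAR := contraction_L2 cA hR.
apply: (contraction_unique cA hu hR hs _ e).
rewrite (opR_congr hs (L2D hu hA) e) opRD; apply: add_congr; [l2..| |exact: RA].
exact: L2plus_R.
Qed.

Lemma opR_MH f : L2 f -> opR (opM (H f)) =F opM (H (opR f)).
Proof.
move=> hf; have hH := L2_H hf; have hRH := L2_opR hH; have hR := L2_opR hf.
rewrite opR_opM -opMN; apply: opM_congr; [l2..|].
rewrite -[in RHS](opprK (H _)); apply: opp_congr; [l2..|exact: opR_H].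
Qed.

Lemma opR_HM f : L2 f -> opR (H (opM f)) =F H (opM (opR f)).
Proof.
move=> hf; have hM := L2_opM hf; have hR := L2_opR hf; have hMR := L2_opM hR.
have hHMR := L2_H hMR.
rewrite (opR_H hM) opR_opM -[in RHS](opprK (H _)); apply: opp_congr; [l2..|].
exact: H_opp.
Qed.

Lemma opR_scaled (c : R) (A : circfun R -> circfun R) :
  (forall f, L2 f -> L2 (A f)) -> (forall f, L2 f -> opR (A f) =F A (opR f)) ->
  forall f, L2 f -> opR (c%:C *: A f) =F (c%:C *: A (opR f)).
Proof.
move=> LA RA f hf; rewrite opRZ.
by apply: scale_congr; [exact/L2_opR/LA|exact/LA/L2_opR|exact: RA].
Qed.

Lemma subcritical_solution h : `|k| < 1 -> L2plus h -> exists s,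
  [/\ L2plus s, ncvg (series (fun n : nat => iter n (fun f => (- k)%:C *: opM (H f)) h)) s &
      (s + k%:C *: MH s) =F h].
Proof.
move=> k1 hp; have hh := L2plus_L2 hp.
have k1' : `|- k| < 1 by rewrite normrN.
have cA := contraction_MH k1'.
have hu (n : nat) : L2 (iter n (fun f => (- k)%:C *: opM (H f)) h).
  by elim: n => [|n IH]; [exact: hh|rewrite iterS; l2].
have [s [hs cs es]] := neumann cA hu (fun=> erefl).
exists s; split => //; last by apply/neg_fixpoint.
apply: (L2plus_fixpoint cA hp hs _ es).
apply: opR_scaled => [f hf|f hf]; [l2|exact: opR_MH].
Qed.

Lemma subcritical_unique h s s' : `|k| < 1 -> L2 h -> L2 s -> L2 s' ->
  (s + k%:C *: MH s) =F h -> (s' + k%:C *: MH s') =F h -> s =F s'.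
Proof.
move=> k1 hh hs hs' /(neg_fixpoint hh hs) e /(neg_fixpoint hh hs') e'.
have k1' : `|- k| < 1 by rewrite normrN.
exact: (contraction_unique (contraction_MH k1') hh hs hs' e e').
Qed.

Lemma nrm_H_mean0 d : L2 d -> fourier d 0 = 0 -> nrm (H d) = nrm d.
Proof.
move=> hd d0; apply/eqP; rewrite eq_le (nrm_H hd) /=.
rewrite -[leLHS]nrmN -(nrm_congr (L2_H (L2_H hd)) (L2N hd) (HK hd d0)).
by apply: nrm_H; l2.
Qed.

(** On functions of mean zero ||Cd|| = ||d||, so ||d|| = |k| ||d||. *)
Lemma supercritical_kernel d : 1 < `|k| -> L2 d -> fourier d 0 = 0 ->
  (d + k%:C *: MH d) =F 0 -> d =F 0.
Proof.
move=> k1 hd d0 /(neg_fixpoint (@L20 R) hd) e; have hM := L2_MH hd.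
have := nrm_congr hd (L2D (@L20 R) (L2Z _ hM)) e.
rewrite add0r (nrmZ _ hM) normcR normrN /MH (nrm_opM (L2_H hd)) (nrm_H_mean0 hd d0).
have n0 := nrm_ge0 d => nd; apply: nrm_eq0_fourier => //; rewrite subr0.
move: (nrm d) n0 nd => x x0 xk; apply/eqP; rewrite eq_le x0 andbT leNgt.
by apply/negP => x1; move/eqP: xk; rewrite lt_eqF// ltr_pMl.
Qed.

(** The sum s of the Neumann series satisfies ks = HM(h + s).  Applying C gives
    kCs = - (h + s), which is the equation for - s; taking norms gives the bound. *)
Lemma supercritical_solution h : 1 < `|k| -> L2plus h -> exists s,
  [/\ L2plus s, fourier s 0 = 0,
      ncvg (series (fun n : nat => (k%:C ^+ n.+1)^-1 *: iter n.+1 (fun f => H (opM f)) h)) s,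
      (- s + k%:C *: MH (- s)) =F h & nrm s <= (`|k| - 1)^-1 * nrm h].
Proof.
move=> k1 hp; have hh := L2plus_L2 hp.
have kn0 : k != 0 by rewrite -normr_gt0 (lt_trans ltr01).
have k1' : `|k^-1| < 1 by rewrite normfV invf_lt1// (lt_trans ltr01).
have cA := contraction_HM k1'.
have hi (n : nat) : L2 (iter n (fun f => H (opM f)) h).
  by elim: n => [|n IH]; [exact: hh|rewrite iterS; l2].
pose u (n : nat) := (k%:C ^+ n.+1)^-1 *: iter n.+1 (fun f => H (opM f)) h.
have hu (n : nat) : L2 (u n) by apply: L2Z.
have uS (n : nat) : u n.+1 =F ((k^-1)%:C *: H (opM (u n))).
  rewrite /u iterS opMZ; set v := iter n.+1 _ h; have hv : L2 v by exact: hi.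
  have hMv := L2_opM hv.
  transitivity (fourier ((k^-1)%:C *: ((k%:C ^+ n.+1)^-1 *: H (opM v)))).
    by rewrite scalerA exprS invfM fmorphV.
  by apply: scale_congr; [l2..|]; rewrite (H_scale _ hMv).
have [s [hs cs es]] := neumann cA hu uS.
have hMh := L2_opM hh; have hMs := L2_opM hs.
have u0E : u 0%N = (k^-1)%:C *: H (opM h) by rewrite /u /= expr1 fmorphV.
have hHM : L2plus (H (opM h)) by exact: L2plus_HM.
have sp : L2plus s.
  apply: (L2plus_fixpoint cA _ hs _ es); first by rewrite u0E; exact: L2plusZ.
  apply: opR_scaled => [f hf|f hf]; [l2|exact: opR_HM].
have es' : s =F ((k^-1)%:C *: H (opM (h + s))).
  rewrite es u0E -scalerDr opMD; apply: scale_congr; [l2..|].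
  by rewrite (H_add hMh hMs).
have hhs := L2D hh hs; have hMhs := L2_opM hhs; have hHMhs := L2_H hMhs.
exists s; split => //.
- by rewrite es' (fourierZ _ 0 hHMhs) (mean_H hMhs) mulr0.
- have hHs := L2_H hs; have hMH := L2_MH hs.
  have kMH : (k%:C *: MH s) =F (- (h + s)).
    rewrite -(MHHM (L2plusD hp sp)) /MH -opMZ; apply: opM_congr; [l2..|].
    rewrite -(H_scale _ hs); apply: H_congr; [l2..|].
    apply/funext => n; rewrite (fourierZ _ n hs) es' (fourierZ _ n hHMhs) mulrA -rmorphM.
    by rewrite divff// rmorph1 mul1r.
  apply/funext => n.
  have hMN : MH (- s) =F (- MH s).
    by rewrite /MH -opMN; apply: opM_congr; [l2..|exact: H_opp].
  have hMHN : L2 (MH (- s)) by l2.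
  rewrite (fourierD n (L2N hs) (L2Z _ hMHN)) (fourierZ _ n hMHN) hMN (fourierN n hMH).
  rewrite mulrN -(fourierZ _ n hMH) kMH (fourierN n hhs) (fourierN n hs) opprK.
  by rewrite (fourierD n hh hs) addrCA addNr addr0.
- have := nrm_congr hs (L2Z _ hHMhs) es'.
  rewrite (nrmZ _ hHMhs) normcR normfV => ns.
  have b : nrm (H (opM (h + s))) <= nrm h + nrm s.
    apply: le_trans (nrm_H hMhs) _; rewrite (nrm_opM hhs); exact: nrm_triangle.
  have kp : 0 < `|k| by rewrite normr_gt0.
  have kns : `|k| * nrm s = nrm (H (opM (h + s))).
    have kn : `|k| != 0 by rewrite normr_eq0.
    by rewrite ns (mulVKf kn).
  rewrite -kns in b; have km : 0 < `|k| - 1 by rewrite subr_gt0.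
  have kmn : `|k| - 1 != 0 by rewrite gt_eqF.
  by rewrite -(ler_pM2l km) (mulVKf kmn) mulrBl mul1r lerBlDr.
Qed.

(** ** The resonance at the critical value *)

(** The images of the constant 1 under the isometry HM.  C annihilates the constants
    and shifts this sequence down, up to sign, so it acts on the closed span as a
    unilateral backward shift. *)
Definition chain (n : nat) : circfun R := iter n (fun f => H (opM f)) (cst 1).

Lemma L2_cst1 : L2 (cst 1 : circfun R).
Proof. by rewrite -expi0; exact: L2_expi. Qed.

Lemma inner_cst1 f : inner f (cst 1) = fourier f 0.
Proof. by rewrite /fourier expi0. Qed.

Lemma L2plus_cst1 : L2plus (cst 1 : circfun R).
Proof. by apply/L2plusP; split => //; exact: L2_cst1. Qed.

Lemma L2plus_chain (n : nat) : L2plus (chain n).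
Proof.
by elim: n => [|n IH]; [exact: L2plus_cst1|rewrite /chain iterS; exact: L2plus_HM].
Qed.

Lemma L2_chain (n : nat) : L2 (chain n). Proof. exact/L2plus_L2/L2plus_chain. Qed.

(** HM preserves inner products because H is skew-adjoint, H^2 = -I on functions of
    mean zero, and M is a self-adjoint involution. *)
Lemma inner_HM f g : L2plus f -> L2plus g -> inner (H (opM f)) (H (opM g)) = inner f g.
Proof.
move=> hfp hgp; have hf := L2plus_L2 hfp; have hg := L2plus_L2 hgp.
have hMf := L2_opM hf; have hMg := L2_opM hg; have hHg := L2_H hMg.
rewrite (inner_H hMf hHg) (innerC (L2_H hHg) hMf).
rewrite (inner_congr (L2_H hHg) (L2N hMg) hMf (HK hMg (mean_opM hgp))).
by rewrite -(innerC (L2N hMg) hMf) (innerNr hMf hMg) opprK (inner_opMM hf hg).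
Qed.

(** HM is an isometry and its range is orthogonal to the constants. *)
Lemma inner_chain (m n : nat) : inner (chain m) (chain n) = (m == n)%:R.
Proof.
have h0 (j : nat) : inner (chain j.+1) (chain 0) = 0.
  rewrite inner_cst1 /chain iterS; apply: mean_H.
  exact: L2_opM (L2_chain j).
elim: m n => [|m IH] [|n].
- by rewrite inner_cst1 /chain /= -expi0 fourier_expi.
- by rewrite (innerC (L2_chain n.+1) (L2_chain 0)) h0 rmorph0.
- exact: h0.
- by rewrite /chain !iterS (inner_HM (L2plus_chain m) (L2plus_chain n)) IH.
Qed.

Lemma nrm_chain (n : nat) : nrm (chain n) = 1.
Proof.
apply/eqP; rewrite -(eqrXn2 (n := 2)) ?nrm_ge0// sqr_nrmE inner_chain eqxx.
by rewrite expr1n.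
Qed.

(** Coefficients that are square-summable but, multiplied by k^i with |k| = 1, not
    summable. *)
Definition resonance (N : nat) : circfun R :=
  \sum_(i < N) ((k ^+ i / i.+1%:R)%:C *: chain i).

Lemma L2_resonance N : L2 (resonance N).
Proof. by apply: L2_sum => i; apply: L2Z; exact: L2_chain. Qed.

Lemma inner_resonance (N j : nat) :
  inner (resonance N) (chain j) = if (j < N)%N then (k ^+ j / j.+1%:R)%:C else 0.
Proof.
elim: N => [|N IH].
  by rewrite /resonance big_ord0 (inner0l (L2_chain j)).
have hc := L2Z (k ^+ N / N.+1%:R)%:C (L2_chain N).
rewrite /resonance big_ord_recr /= -/(resonance N).
rewrite (innerDl (L2_resonance N) hc (L2_chain j)) IH.
rewrite (innerZl _ (L2_chain N) (L2_chain j)) inner_chain ltnS [(j <= N)%N]leq_eqVlt.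
have [->|jN] := eqVneq j N; first by rewrite ltnn mulr1 add0r.
by rewrite mulr0 addr0.
Qed.

Lemma resonance_limit : `|k| = 1 -> exists h, L2 h /\
  forall j : nat, inner h (chain j) = (k ^+ j / j.+1%:R)%:C.
Proof.
(* 1/(n+1)^2 <= 2/((n+1)(n+2)) = A (n+1) - A n *)
move=> k1; pose A (n : nat) : R := 2 - 2 / n.+1%:R.
have kk (n : nat) : (k ^+ n) ^+ 2 = 1.
  by rewrite exprAC -(real_normK (num_real k)) k1 !expr1n.
have inc (m n : nat) : (m <= n)%N ->
    nrm (resonance n - resonance m) ^+ 2 <= A n - A m.
  move=> mn; rewrite -(subnK mn); elim: (n - m)%N => [|i IH].
    rewrite add0n !subrr; have := nrmZ 0 (@L20 R).
    by rewrite scale0r Normc.normc0 mul0r => ->; rewrite expr0n.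
  rewrite addSn; set N := (i + m)%N in IH *; have mN : (m <= N)%N by exact: leq_addl.
  have hd := L2B (L2_resonance N) (L2_resonance m).
  have hc := L2Z (k ^+ N / N.+1%:R)%:C (L2_chain N).
  rewrite [resonance N.+1]/resonance big_ord_recr /= -/(resonance N) addrAC.
  rewrite (nrmD_sqr hd hc) (innerZr _ hd (L2_chain N)).
  rewrite (innerBl (L2_resonance N) (L2_resonance m) (L2_chain N)) !inner_resonance.
  rewrite ltnn ltnNge mN subrr mulr0 mulr0 addr0.
  rewrite (nrmZ _ (L2_chain N)) nrm_chain mulr1 normcR real_normK ?num_real//.
  rewrite exprMn kk mul1r.
  have : A N.+1 = A N + 2 / (N.+1%:R * N.+2%:R).
    have x0 : 0 < N.+1%:R :> R by rewrite ltr0n.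
    rewrite /A -[N.+2%:R]natr1; move: (N.+1%:R) x0 => x x0.
    by field; rewrite !gt_eqF ?addr_gt0.
  have : N.+1%:R^-1 ^+ 2 <= 2 / (N.+1%:R * N.+2%:R) :> R.
    rewrite exprVn ler_pdivlMr ?mulr_gt0 ?ltr0n// mulrC ler_pdivrMr ?exprn_gt0 ?ltr0n//.
    rewrite -natrM -natrX -natrM ler_nat; lia.
  by move=> h1 h2; rewrite h2 addrAC lerD.
have AB (n : nat) : A n <= 2 by rewrite /A gerBl divr_ge0.
have [h [hh ch]] := L2_cvg_bounded_increments L2_resonance AB inc.
exists h; split => // j.
apply: (inner_lim_near L2_resonance hh (L2_chain j) ch).
near=> N; rewrite inner_resonance ifT//.
by near: N; exact: nbhs_infty_gt.
Unshelve. all: by end_near. Qed.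

Lemma inner_opPi h y : L2 h -> L2plus y -> inner (opPi h) y = inner h y.
Proof.
move=> hh hp; have hy := L2plus_L2 hp; have hR := L2_opR hh; have hRy := L2_opR hy.
rewrite /opPi (innerZl _ (L2D hh hR) hy) (innerDl hh hR hy).
have -> : inner (opR h) y = inner h y.
  rewrite -[in LHS](opRK y) (inner_opR hh hRy) (innerC hRy hh).
  by rewrite (inner_congr hRy hy hh (L2plus_R hp)) -(innerC hy hh).
exact: half_sum.
Qed.

(** With r n = <y, e_n>, pairing the equation with e_n gives
    r n - k r (n+1) = k^n/(n+1).  Multiplied by k^n it telescopes: the partial sums of
    the harmonic series are r 0 - k^n r n, which stays bounded. *)
Lemma resonance_unsolvable : `|k| = 1 -> exists h, L2 h /\
  forall y, L2plus y -> ~ (y + k%:C *: MH y) =F opPi h.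
Proof.
move=> k1; have [h [hh ch]] := resonance_limit k1; exists h; split => // y hp e.
have hy := L2plus_L2 hp; have hM := L2_MH hy; have hH := L2_H hy.
pose r (j : nat) := complex.Re (inner y (chain j)).
have kk (n : nat) : k ^+ n * k ^+ n = 1.
  by rewrite -expr2 exprAC -(real_normK (num_real k)) k1 !expr1n.
have rec (j : nat) : r j - k * r j.+1 = k ^+ j / j.+1%:R.
  have hc := L2_chain j; have hMc := L2_opM hc.
  have := ch j; rewrite -(inner_opPi hh (L2plus_chain j)).
  rewrite -(inner_congr (L2D hy (L2Z _ hM)) (L2_opPi hh) hc e).
  rewrite (innerDl hy (L2Z _ hM) hc) (innerZl _ hM hc) /MH inner_opM (inner_H hy hMc).
  rewrite -[H (opM (chain j))]/(chain j.+1) => ec.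
  rewrite -[RHS]/(complex.Re (k ^+ j / j.+1%:R)%:C) -ec /r.
  by case: (inner y (chain j)) (inner y (chain j.+1)) => a b [c d] /=; ring.
have tele (n : nat) : series (@harmonic R) n = r 0%N - k ^+ n * r n.
  elim: n => [|n IH]; first by rewrite /series /= big_geq// mul1r subrr.
  rewrite /series /= big_nat_recr //= -[X in X + _]/(series (@harmonic R) n) IH.
  have := congr1 (fun x => k ^+ n * x) (rec n); rewrite mulrA kk mul1r => <-.
  by rewrite exprSr; ring.
have rb (n : nat) : `|k ^+ n * r n| <= nrm y.
  rewrite normrM normrX k1 expr1n mul1r.
  by have [+ _] := inner_bound hy (L2_chain n); rewrite nrm_chain mulr1.
apply: (@dvg_harmonic R); apply: nondecreasing_is_cvgn.
  by apply: nondecreasing_series => n _ _; exact: harmonic_ge0.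
exists (nrm y + nrm y) => _ [n _ <-]; rewrite tele.
have := rb 0%N; have := rb n; rewrite mul1r !ler_norml => /andP[h1 h2] /andP[h3 h4].
lra.
Qed.

(** ** Solutions of the boundary equation *)

Lemma MHD y y' : L2 y -> L2 y' -> MH (y + y') =F (MH y + MH y').
Proof.
move=> hy hy'; have hH := L2_H hy; have hH' := L2_H hy'.
by rewrite /MH -opMD; apply: opM_congr; [l2..|exact: H_add].
Qed.

Lemma MHZ a y : L2 y -> MH (a *: y) =F (a *: MH y).
Proof.
by move=> hy; rewrite /MH -opMZ; apply: opM_congr; [l2..|exact: H_scale].
Qed.

Definition IkC y := y + k%:C *: MH y.

Lemma L2_IkC y : L2 y -> L2 (IkC y).
Proof. by move=> hy; rewrite /IkC; l2. Qed.
Hint Resolve L2_IkC : l2.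

Lemma IkCD y y' : L2 y -> L2 y' -> IkC (y + y') =F (IkC y + IkC y').
Proof.
move=> hy hy'; have hM := L2_MH hy; have hM' := L2_MH hy'.
have hS := L2_MH (L2D hy hy').
rewrite /IkC addrACA -scalerDr; apply: add_congr; [l2..|by []|].
by apply: scale_congr; [l2..|exact: MHD].
Qed.

Lemma IkCZ a y : L2 y -> IkC (a *: y) =F (a *: IkC y).
Proof.
move=> hy; have hM := L2_MH hy; have hS := L2_MH (L2Z a hy).
rewrite /IkC scalerDr scalerA (mulrC a) -scalerA.
by apply: add_congr; [l2..|by []|apply: scale_congr; [l2..|exact: MHZ]].
Qed.

Lemma IkCB y y' : L2 y -> L2 y' -> IkC (y - y') =F (IkC y - IkC y').
Proof.
move=> hy hy'; rewrite (IkCD hy (L2N hy')); apply: add_congr; [l2..|by []|].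
by rewrite -(scaleN1r y') (IkCZ _ hy') scaleN1r.
Qed.

Lemma IkC_cst1 : IkC (cst 1) =F (cst 1 : circfun R).
Proof.
have h1 := L2_cst1; have hH := L2_H h1.
have H1 : H (cst 1) =F 0.
  apply/funext => n; rewrite (fourier_H n h1) -expi0 fourier_expi.
  rewrite -(scale0r (0 : circfun R)) (fourierZ _ n (@L20 R)) mul0r.
  have [<-|_] := eqVneq 0 n; last by rewrite mulr0.
  by rewrite /sgnc sgz0 mulr0z mulr0 mul0r.
have MH1 : MH (cst 1) =F 0.
  rewrite /MH (opM_congr hH (@L20 R) H1).
  by rewrite -(scale0r (0 : circfun R)) opMZ !scale0r.
apply/funext => n; rewrite (fourierD n h1 (L2Z _ (L2_MH h1))) (fourierZ _ n (L2_MH h1)) MH1.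
by rewrite -(scale0r (0 : circfun R)) (fourierZ _ n (@L20 R)) mul0r mulr0 addr0.
Qed.

(** The boundary equation with T expanded, for the abstract operators. *)
Definition boundary g psi : Prop :=
  ae_equal ((2 * 'i%C) *: psi + k%:C *: B (opM (psi - opR psi))) (B g).

Lemma boundaryE g psi : L2 g -> L2 psi -> boundary g psi <->
  ((2 * 'i%C) *: psi + k%:C *: B (opM (psi - opR psi))) =F B g.
Proof. by move=> hg hpsi; apply: ae_fourier; l2. Qed.

Lemma scale_inv_fourier a f g : a != 0 -> L2 f -> L2 g ->
  (a *: f) =F g <-> f =F (a^-1 *: g).
Proof.
move=> a0 hf hg; split => e; apply/funext => n.
  by rewrite (fourierZ _ n hg) -e (fourierZ _ n hf) mulKf.
by rewrite (fourierZ _ n hf) e (fourierZ _ n hg) mulVKf.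
Qed.

Lemma boundary_IkC g y psi : L2 g -> L2plus y -> L2 psi -> psi =F cauchy y ->
  boundary g psi <-> IkC y =F ((2 * 'i%C)^-1 *: opPi g).
Proof.
move=> hg hp hpsi e; have hy := L2plus_L2 hp.
rewrite (boundaryE hg hpsi) (boundary_cauchy hg hp hpsi e).
by apply: scale_inv_fourier; [exact: two_i_neq0|l2..].
Qed.

Lemma boundary_cauchyE g y : L2 g -> L2plus y ->
  boundary g (cauchy y) <-> IkC y =F ((2 * 'i%C)^-1 *: opPi g).
Proof. by move=> hg hp; apply: boundary_IkC => //; exact/L2_cauchy/L2plus_L2. Qed.

Lemma boundary_opPi g psi : L2 g -> L2 psi -> boundary g psi ->
  psi =F cauchy (opPi psi) /\ IkC (opPi psi) =F ((2 * 'i%C)^-1 *: opPi g).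
Proof.
move=> hg hpsi bd; have e := boundary_form hg hpsi ((boundaryE hg hpsi).1 bd).
by split => //; apply/(boundary_IkC hg (L2plus_opPi hpsi) hpsi e).
Qed.

Lemma IkC_scaled_solution a h s : L2 h -> L2 s -> IkC s =F h -> IkC (a *: s) =F (a *: h).
Proof. by move=> hh hs e; rewrite (IkCZ a hs); apply: scale_congr; [l2..|]. Qed.

Theorem subcritical_boundary : `|k| < 1 -> forall g, L2 g -> exists s,
  let y := (2 * 'i%C)^-1 *: s in
  let psi := cauchy y in
  [/\ L2 s,
      L2cvg (series (fun n : nat => iter n (fun f => (- k)%:C *: opM (H f)) (opPi g))) s,
      L2 psi, boundary g psi &
      forall psi', L2 psi' -> boundary g psi' -> ae_equal psi' psi].
Proof.
move=> k1 g hg; have hPi := L2_opPi hg; have hPip := L2plus_opPi hg.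
have [s [sp cs es]] := subcritical_solution k1 hPip.
have hs := L2plus_L2 sp; exists s => y psi.
have yp : L2plus y by exact: L2plusZ.
have hy := L2plus_L2 yp; have hpsi := L2_cauchy hy.
have ey : IkC y =F ((2 * 'i%C)^-1 *: opPi g) by exact: IkC_scaled_solution.
split => //.
- apply/L2cvgE => // n; apply: L2_sum => i.
  by elim: i => [|i IH]; [exact: hPi|rewrite iterS; l2].
- exact/boundary_cauchyE.
- move=> psi' hpsi' /(boundary_opPi hg hpsi')[e1 e2].
  apply/ae_fourier => //; rewrite e1; apply: cauchy_congr; [l2..|].
  have hr : L2 ((2 * 'i%C)^-1 *: opPi g) by l2.
  exact: (subcritical_unique k1 hr (L2_opPi hpsi') hy e2 ey).
Qed.

Lemma opPiZ a f : opPi (a *: f) = a *: opPi f.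
Proof. by rewrite /opPi opRZ -scalerDr !scalerA mulrC. Qed.

Theorem critical_boundary : `|k| = 1 -> exists g, L2 g /\
  forall psi, L2 psi -> ~ boundary g psi.
Proof.
move=> k1; have [h [hh nh]] := resonance_unsolvable k1.
exists ((2 * 'i%C) *: h); have hg : L2 ((2 * 'i%C) *: h) by l2.
split => // psi hpsi /(boundary_opPi hg hpsi)[_ e].
apply: (nh _ (L2plus_opPi hpsi)); rewrite -/(IkC _) e.
by rewrite opPiZ scalerA mulVf ?two_i_neq0// scale1r.
Qed.

Lemma opPiD f g : opPi (f + g) = opPi f + opPi g.
Proof. by rewrite /opPi opRD -scalerDr addrACA. Qed.

(** For |k| > 1 these conditions determine y up to a.e. equality. *)
Definition selected g y := [/\ L2plus y, fourier y 0 = 0 &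
  IkC y =F ((2 * 'i%C)^-1 *: opPi g)].

Lemma selected_unique g y y' : 1 < `|k| -> L2 g -> selected g y -> selected g y' -> y =F y'.
Proof.
move=> k1 hg [yp y0 ey] [yp' y0' ey']; have hy := L2plus_L2 yp; have hy' := L2plus_L2 yp'.
have hd := L2B hy hy'; have h0 := @L20 R.
have e : (y - y') =F 0.
  apply: (supercritical_kernel k1 hd); first by rewrite (fourierB 0 hy hy') y0 y0' subrr.
  rewrite -/(IkC _) (IkCB hy hy'); apply/funext => n.
  rewrite (fourierB n (L2_IkC hy) (L2_IkC hy')) ey ey' subrr.
  by rewrite -(scale0r (0 : circfun R)) (fourierZ _ n h0) mul0r.
apply: nrm_eq0_fourier => //; rewrite (nrm_congr hd h0 e).
by have := nrmZ 0 h0; rewrite scale0r Normc.normc0 mul0r.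
Qed.

(** The product of the norm of 1/2i, the bound (|k| - 1)^-1 of the inverse on functions
    of mean zero, and the norm 1/2 * 2 with which P is estimated. *)
Definition selection_bound : R := Normc.normc ((2 * 'i%C : R[i])^-1) *
  ((`|k| - 1)^-1 * (Normc.normc (2^-1 : R[i]) * 2)).

Lemma selected_exists g : 1 < `|k| -> L2 g -> exists s,
  [/\ L2 s,
      L2cvg (series (fun n : nat => (k%:C ^+ n.+1)^-1 *:
        iter n.+1 (fun f => H (opM f)) (opPi g))) s,
      selected g (- ((2 * 'i%C)^-1 *: s)) &
      nrm (- ((2 * 'i%C)^-1 *: s)) <= selection_bound * nrm g].
Proof.
move=> k1 hg; have hPi := L2_opPi hg; have hPip := L2plus_opPi hg.
have [s [sp s0 cs es bs]] := supercritical_solution k1 hPip.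
have hs := L2plus_L2 sp; have hNs := L2N hs; exists s; split => //.
- apply/L2cvgE => // n; apply: L2_sum => i; apply: L2Z.
  by elim: (i.+1) => [|j IH]; [exact: hPi|rewrite iterS; l2].
- rewrite -scalerN; split; first by apply: L2plusZ; exact: L2plusN.
    by rewrite (fourierZ _ 0 hNs) (fourierN 0 hs) s0 oppr0 mulr0.
  exact: IkC_scaled_solution.
- rewrite nrmN (nrmZ _ hs) /selection_bound -mulrA.
  apply: ler_wpM2l; first by rewrite normc_sqrt sqrtr_ge0.
  apply: (le_trans bs); rewrite -mulrA.
  apply: ler_wpM2l; first by rewrite invr_ge0 subr_ge0 ltW.
  rewrite /opPi (nrmZ _ (L2D hg (L2_opR hg))) -mulrA.
  apply: ler_wpM2l; first by rewrite normc_sqrt sqrtr_ge0.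
  have := nrm_triangle hg (L2_opR hg); rewrite (nrm_opR hg); lra.
Qed.

Lemma IkC_surjective : 1 < `|k| -> forall h, L2plus h ->
  exists y, L2plus y /\ ae_equal (IkC y) h.
Proof.
move=> k1 h hp; have [s [sp _ _ es _]] := supercritical_solution k1 hp.
have np := L2plusN sp; exists (- s); split => //.
by apply/(ae_fourier (L2_IkC (L2plus_L2 np)) (L2plus_L2 hp)).
Qed.

(** I + kC fixes the constant 1, and by surjectivity also maps a function of mean zero
    to 1; the difference of the two is in the kernel. *)
Lemma IkC_kernel : 1 < `|k| -> exists d, [/\ L2plus d, fourier d 0 = 1 & IkC d =F 0].
Proof.
move=> k1; have [s [sp s0 _ es _]] := supercritical_solution k1 L2plus_cst1.
have hs := L2plus_L2 sp; have h1 := L2_cst1.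
exists (cst 1 - (- s)); split; first by apply: L2plusB; [exact: L2plus_cst1|exact: L2plusN].
  by rewrite (fourierB 0 h1 (L2N hs)) (fourierN 0 hs) s0 oppr0 subr0 -expi0 fourier_expi.
rewrite (IkCB h1 (L2N hs)); apply/funext => n.
rewrite (fourierB n (L2_IkC h1) (L2_IkC (L2N hs))) IkC_cst1 [fourier (IkC (- s))]es subrr.
by rewrite -(scale0r (0 : circfun R)) (fourierZ _ n (@L20 R)) mul0r.
Qed.

Lemma IkC_add_kernel y d : L2 y -> L2 d -> IkC d =F 0 -> IkC (y + d) =F IkC y.
Proof.
move=> hy hd ed; apply/funext => n.
rewrite (IkCD hy hd) (fourierD n (L2_IkC hy) (L2_IkC hd)) ed.
by rewrite -(scale0r (0 : circfun R)) (fourierZ _ n (@L20 R)) mul0r addr0.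
Qed.

Lemma IkC_not_injective : 1 < `|k| -> exists y1 y2,
  [/\ L2plus y1, L2plus y2, ~ ae_equal y1 y2 & ae_equal (IkC y1) (IkC y2)].
Proof.
move=> k1; have [d [dp d1 ed]] := IkC_kernel k1; have hd := L2plus_L2 dp.
have p1 := L2plus_cst1; have h1 := L2plus_L2 p1; have hs := L2D h1 hd.
exists (cst 1 + d), (cst 1); split => //; first exact: L2plusD.
  move=> /(ae_fourier hs h1) e; have := congr1 (fun F => F 0) e.
  by rewrite (fourierD 0 h1 hd) d1 => /eqP; rewrite -subr_eq0 addrAC subrr add0r oner_eq0.
by apply/ae_fourier; [l2..|exact: IkC_add_kernel].
Qed.

Lemma boundary_solvable : 1 < `|k| -> forall g, L2 g ->
  exists psi, L2 psi /\ boundary g psi.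
Proof.
move=> k1 g hg; have [s [_ _ [yp y0 ey] _]] := selected_exists k1 hg.
exists (cauchy (- ((2 * 'i%C)^-1 *: s))); split; first exact/L2_cauchy/L2plus_L2.
exact/boundary_cauchyE.
Qed.

Lemma boundary_not_unique : 1 < `|k| -> forall g, L2 g -> exists psi1 psi2,
  [/\ L2 psi1, L2 psi2, boundary g psi1, boundary g psi2 & ~ ae_equal psi1 psi2].
Proof.
move=> k1 g hg; have [s [_ _ [yp y0 ey] _]] := selected_exists k1 hg.
have [d [dp d1 ed]] := IkC_kernel k1; have hd := L2plus_L2 dp.
move: (- _) yp y0 ey => y yp y0 ey; have hy := L2plus_L2 yp.
have ydp := L2plusD yp dp; have hyd := L2D hy hd.
exists (cauchy (y + d)), (cauchy y); split; [exact: L2_cauchy..| | |].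
- by apply/(boundary_cauchyE hg ydp); rewrite (IkC_add_kernel hy hd ed).
- exact/boundary_cauchyE.
- move=> /(ae_fourier (L2_cauchy hyd) (L2_cauchy hy)) /(cauchy_inj ydp yp) e.
  have := congr1 (fun F => F 0) e.
  by rewrite (fourierD 0 hy hd) d1 y0 add0r => /eqP; rewrite oner_eq0.
Qed.

Lemma boundary_solution_form g psi : L2 g -> L2 psi -> boundary g psi ->
  exists y, L2plus y /\ ae_equal psi (cauchy y).
Proof.
move=> hg hpsi /(boundary_opPi hg hpsi)[e _]; exists (opPi psi).
split; first exact: L2plus_opPi.
by apply/ae_fourier => //; l2.
Qed.

Lemma supercritical_selection : 1 < `|k| -> forall g, L2 g -> exists s,
  let y := - ((2 * 'i%C)^-1 *: s) in
  [/\ L2 s,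
      L2cvg (series (fun n : nat => (k%:C ^+ n.+1)^-1 *:
        iter n.+1 (fun f => H (opM f)) (opPi g))) s,
      [/\ L2plus y, inner y (cst 1) = 0, L2 (cauchy y) & boundary g (cauchy y)] &
      forall y', L2plus y' -> inner y' (cst 1) = 0 -> boundary g (cauchy y') ->
        ae_equal y' y].
Proof.
move=> k1 g hg; have [s [hs cs sy _]] := selected_exists k1 hg.
exists s => y; have [yp y0 ey] := sy; have hy := L2plus_L2 yp.
split => //; first by split; [|rewrite inner_cst1|exact: L2_cauchy|exact/boundary_cauchyE].
move=> y' yp' /[!inner_cst1] y0' /(boundary_cauchyE hg yp') ey'.
apply/ae_fourier => //; first exact: L2plus_L2.
exact: (selected_unique k1 hg).
Qed.

(** Choose a selected solution y for each g; uniqueness makes the choice linear up to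
    a.e. equality, and (I - R) psi = 2i Hy inherits the bound. *)
Lemma supercritical_bounded_selection : 1 < `|k| -> exists G : circfun R -> circfun R,
  bounded_linear_L2 G /\
  forall g y, L2 g -> L2plus y -> inner y (cst 1) = 0 -> boundary g (cauchy y) ->
    let psi := cauchy y in ae_equal (G g) (psi - opR psi).
Proof.
move=> k1.
have /choice[Y HY] : forall g, exists y, L2 g ->
    selected g y /\ nrm y <= selection_bound * nrm g.
  move=> g; have [hg|nh] := pselect (L2 g); last by exists 0.
  have [s [_ _ sy by_]] := selected_exists k1 hg.
  by exists (- ((2 * 'i%C)^-1 *: s)).
have Yp g : L2 g -> L2plus (Y g) by move=> /HY[[]].
have YL g : L2 g -> L2 (Y g) by move=> hg; exact/L2plus_L2/Yp.
have GL g : L2 g -> L2 (cauchy (Y g) - opR (cauchy (Y g))).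
  by move=> /YL hy; have hc := L2_cauchy hy; l2.
have GE g : L2 g -> (cauchy (Y g) - opR (cauchy (Y g))) =F ((2 * 'i%C) *: H (Y g)).
  by move=> hg; exact/cauchyB_R/Yp.
exists (fun g => cauchy (Y g) - opR (cauchy (Y g))); split.
  split => //.
  - move=> a f g hf hg; have haf := L2Z a hf; have hafg := L2D haf hg.
    have hYf := YL _ hf; have hYg := YL _ hg; have hY := YL _ hafg.
    have hHf := L2_H hYf; have hHg := L2_H hYg.
    have haH := L2Z a hHf; have hGf := GL _ hf; have hGg := GL _ hg.
    apply/(ae_fourier (GL _ hafg) (L2D (L2Z a hGf) hGg)).
    have [[pf f0 ef] _] := HY f hf; have [[pg g0 eg] _] := HY g hg.
    have eY : Y (a *: f + g) =F (a *: Y f + Y g).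
      apply: (selected_unique k1 hafg); first by case: (HY _ hafg).
      split; first by apply: L2plusD => //; exact: L2plusZ.
        by rewrite (fourierD 0 (L2Z a hYf) hYg) (fourierZ a 0 hYf) f0 g0 mulr0 addr0.
      rewrite (IkCD (L2Z a hYf) hYg) opPiD opPiZ; apply/funext => n.
      have hPf := L2_opPi hf; have hPg := L2_opPi hg.
      rewrite (fourierD n (L2_IkC (L2Z a hYf)) (L2_IkC hYg)) (IkCZ a hYf).
      rewrite (fourierZ a n (L2_IkC hYf)) ef eg scalerDr.
      have h1 := L2Z (2 * 'i%C)^-1 hPf; have h2 := L2Z (2 * 'i%C)^-1 hPg.
      have h3 := L2Z (2 * 'i%C)^-1 (L2Z a hPf).
      rewrite (fourierD n h3 h2); congr (_ + _).
      by rewrite (fourierZ _ n (L2Z a hPf)) (fourierZ a n hPf) (fourierZ _ n hPf) mulrCA.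
    rewrite (GE _ hafg); apply/funext => n.
    rewrite (fourierD n (L2Z a hGf) hGg) (fourierZ a n hGf) (GE _ hf) (GE _ hg).
    rewrite (fourierZ _ n (L2_H hY)) (fourierZ _ n hHf) (fourierZ _ n hHg).
    rewrite (H_congr hY (L2D (L2Z a hYf) hYg) eY) (H_add (L2Z a hYf) hYg).
    rewrite (fourierD n (L2_H (L2Z a hYf)) hHg) (H_scale a hYf) (fourierZ a n hHf).
    by rewrite mulrDr mulrCA.
  - exists (Normc.normc (2 * 'i%C : R[i]) * selection_bound) => f hf.
    have [_ bf] := HY f hf; have hYf := YL _ hf; have hHf := L2_H hYf.
    rewrite (L2norm_nrm (GL _ hf)) (L2norm_nrm hf) -EFinM lee_fin.
    rewrite (nrm_congr (GL _ hf) (L2Z _ hHf) (GE _ hf)) (nrmZ _ hHf) -mulrA.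
    apply: ler_wpM2l; first by rewrite normc_sqrt sqrtr_ge0.
    exact: le_trans (nrm_H hYf) bf.
move=> g y hg yp; rewrite inner_cst1 => y0 /(boundary_cauchyE hg yp) ey psi.
have hy := L2plus_L2 yp; have hpsi := L2_cauchy hy; have hY := YL _ hg.
have eY : Y g =F y by apply: (selected_unique k1 hg); [case: (HY g hg)|].
apply/(ae_fourier (GL _ hg)); first by l2.
rewrite (GE _ hg) (cauchyB_R yp).
by apply: scale_congr; [l2..|exact: H_congr].
Qed.

End OperatorAlgebra.

Theorem mainTheorem4 (R : realType) (k : R) :
  (`|k| < 1 ->
    forall g : circfun R, L2 g ->
    exists s : circfun R,
      let y := (2 * 'i%C)^-1 *: s in
      let psi := y + 'i%C *: opH y in
      [/\ L2 s,
          L2cvg (series (fun n : nat =>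
            iter n (fun f : circfun R => (- k)%:C *: opM (opH f)) (opPi g))) s,
          L2 psi,
          boundary_eq k g psi &
          forall psi' : circfun R, L2 psi' -> boundary_eq k g psi' ->
            ae_equal psi' psi]) /\
  (`|k| = 1 ->
    exists g : circfun R, L2 g /\
      forall psi : circfun R, L2 psi -> ~ boundary_eq k g psi) /\
  (1 < `|k| ->
    (* I + k C is surjective on L^2_+ *)
    (forall h : circfun R, L2plus h ->
       exists y : circfun R, L2plus y /\ ae_equal (y + k%:C *: opC y) h) /\
    (* I + k C is not injective on L^2_+ *)
    (exists y1 y2 : circfun R,
       [/\ L2plus y1, L2plus y2, ~ ae_equal y1 y2 &
           ae_equal (y1 + k%:C *: opC y1) (y2 + k%:C *: opC y2)]) /\
    (* solvability, without uniqueness *)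
    (forall g : circfun R, L2 g ->
       exists psi : circfun R, L2 psi /\ boundary_eq k g psi) /\
    (forall g : circfun R, L2 g ->
       exists psi1 psi2 : circfun R,
         [/\ L2 psi1, L2 psi2, boundary_eq k g psi1, boundary_eq k g psi2 &
             ~ ae_equal psi1 psi2]) /\
    (* form of the solutions *)
    (forall g psi : circfun R, L2 g -> L2 psi -> boundary_eq k g psi ->
       exists y : circfun R, L2plus y /\ ae_equal psi (y + 'i%C *: opH y)) /\
    (* the solution selected by <y, 1> = 0 *)
    (forall g : circfun R, L2 g ->
       exists s : circfun R,
         let y := - ((2 * 'i%C)^-1 *: s) in
         [/\ L2 s,
             L2cvg (series (fun n : nat =>
               (k%:C ^+ n.+1)^-1 *:
                 iter n.+1 (fun f : circfun R => opH (opM f)) (opPi g))) s,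
             [/\ L2plus y, inner y (cst 1) = 0, L2 (y + 'i%C *: opH y) &
                 boundary_eq k g (y + 'i%C *: opH y)] &
             forall y' : circfun R, L2plus y' -> inner y' (cst 1) = 0 ->
               boundary_eq k g (y' + 'i%C *: opH y') -> ae_equal y' y]) /\
    (* the selection is a bounded linear operator g |-> (I - R) psi *)
    (exists G : circfun R -> circfun R,
       bounded_linear_L2 G /\
       forall g y : circfun R, L2 g -> L2plus y -> inner y (cst 1) = 0 ->
         boundary_eq k g (y + 'i%C *: opH y) ->
         let psi := y + 'i%C *: opH y in
         ae_equal (G g) (psi - opR psi))).
Proof.
split; [|split].
- exact: (subcritical_boundary (@L2_opH R) (@fourier_opH R) (@nrm_opH R)
    (@L2_opB R) (@fourier_opB R)).
- exact: (critical_boundary (@L2_opH R) (@fourier_opH R) (@inner_opH R)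
    (@L2_opB R) (@fourier_opB R)).
- move=> k1; split; [|split; [|split; [|split; [|split; [|split]]]]].
  + exact: (IkC_surjective (@L2_opH R) (@fourier_opH R) (@nrm_opH R) k1).
  + exact: (IkC_not_injective (@L2_opH R) (@fourier_opH R) (@nrm_opH R) k1).
  + exact: (boundary_solvable (@L2_opH R) (@fourier_opH R) (@nrm_opH R)
      (@L2_opB R) (@fourier_opB R) k1).
  + exact: (boundary_not_unique (@L2_opH R) (@fourier_opH R) (@nrm_opH R)
      (@L2_opB R) (@fourier_opB R) k1).
  + exact: (boundary_solution_form (@L2_opH R) (@fourier_opH R)
      (@L2_opB R) (@fourier_opB R)).
  + exact: (supercritical_selection (@L2_opH R) (@fourier_opH R) (@nrm_opH R)
      (@L2_opB R) (@fourier_opB R) k1).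
  + exact: (supercritical_bounded_selection (@L2_opH R) (@fourier_opH R)
      (@nrm_opH R) (@L2_opB R) (@fourier_opB R) k1).
Qed.
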